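(* Let $\mathbb O=(\mathcal A,\Delta,\varepsilon)$ be a comonoid in $(\mathbf{GrAlg},\circ)$. Let $\mathcal B=\mathfrak X_B(\mathbb K)$, $\mathcal C=\mathfrak X_C(\mathbb K)$ for matrix idempotents $B\in\mathrm{End}(\mathbb K^m\otimes\mathbb K^m)$, $C\in\mathrm{End}(\mathbb K^n\otimes\mathbb K^n)$, and let $D=\mathrm{DiS}(B,C)$. Let $\delta$ and $\gamma$ be coactions of $\mathbb O$ on $\mathcal B$ and $\mathcal C$ given by multiplicative first order $B$- and $C$-Manin matrices $M$ and $N$ respectively, and let $\omega=\vartheta^{-1}(\delta)$, $\nu=\vartheta^{-1}(\gamma)$ be the corresponding corepresentations. The direct sum of the coactions $\delta,\gamma$ exists if and only if $M$ and $N$ commute entry-wise: $$M^i_jN^a_b=N^a_bM^i_j\qquad\forall\, i,j=1,\dots,m,\ a,b=1,\dots,n.$$ Thus the direct sum of the corepresentations $\omega,\nu$ exists if and only if $M$ and $N$ satisfy this condition. In this case the coaction $\delta\dotplus\gamma\colon\mathfrak X_D(\mathbb K)\to\mathcal A\circ\mathfrak X_D(\mathbb K)$ and the corepresentation $\omega\dotplus\nu\colon\mathbf{coend}(\mathfrak X_D(\mathbb K))\to\mathbb O$ are given by the multiplicative first order $D$-Manin matrix $M\oplus N=\begin{pmatrix}M&0\\0&N\end{pmatrix}$.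
   Context: $\mathbb K$ is an infinite field with $\mathrm{char}\,\mathbb K\ne2$. Algebras are unital associative over $\mathbb K$. $\mathbf{GrAlg}$ is the category of $\mathbb N_0$-graded algebras. $\mathcal A\circ\mathcal B$ (Manin product) is the subalgebra of $\mathcal A\otimes\mathcal B$ with graded components $\mathcal A_k\otimes\mathcal B_k$; $(\mathbf{GrAlg},\circ)$ is symmetric monoidal with unit $\mathbb K[u]$. For a comonoid $\mathbb O=(\mathcal A,\Delta,\varepsilon)$, $\Delta_{\mathcal A}\colon\mathcal A\to\mathcal A\otimes\mathcal A$ is $\Delta$ followed by $\mathcal A\circ\mathcal A\subset\mathcal A\otimes\mathcal A$, and $\varepsilon_{\mathcal A}\colon\mathcal A\to\mathbb K$ is $\varepsilon$ followed by $u\mapsto1$. $\mathfrak X_B(\mathbb K)$ is the quadratic algebra with degree-one generators $w^1,\dots,w^m$ and relations $\sum_{k,l}B^{ij}_{kl}w^kw^l=0$. A $B$-Manin matrix is an $m\times m$ matrix $M$ over an algebra with $\sum B^{ij}_{ab}M^a_cM^b_d(\delta^c_k\delta^d_l-B^{cd}_{kl})=0$ for all $i,j,k,l$ (sum over $a,b,c,d$). A matrix $M$ over $\mathcal A$ is first order if $M^i_j\in\mathcal A_1$, and multiplicative if $\Delta_{\mathcal A}(M^i_j)=\sum_kM^i_k\otimes M^k_j$, $\varepsilon_{\mathcal A}(M^i_j)=\delta^i_j$. A coaction of $\mathbb O$ on $\mathcal B$ is a graded homomorphism $\delta\colon\mathcal B\to\mathcal A\circ\mathcal B$ that is coassociative,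 $(\Delta\circ\mathrm{id})\cdot\delta=(\mathrm{id}\circ\delta)\cdot\delta$, and counital, $(\varepsilon\circ\mathrm{id})\cdot\delta=\mathrm{id}$. $\mathbf{coend}(\mathfrak X_B(\mathbb K))$ is the comonoid with degree-one generators $\mathcal M^i_j$, relations $B\mathcal M^{(1)}\mathcal M^{(2)}(1-B)=0$ (i.e. $\mathcal M$ is a $B$-Manin matrix), comultiplication $\mathcal M^i_j\mapsto\sum_k\mathcal M^i_k\otimes\mathcal M^k_j$ and counit $\mathcal M^i_j\mapsto\delta^i_ju$; a corepresentation of $\mathbb O$ on $\mathfrak X_B(\mathbb K)$ is a comonoid morphism $\omega\colon\mathbf{coend}(\mathfrak X_B(\mathbb K))\to\mathbb O$. Coactions and corepresentations on $\mathfrak X_B(\mathbb K)$ are both in bijection with multiplicative first order $B$-Manin matrices $M$ over $\mathcal A$ via $\delta(w^i)=\sum_jM^i_j\otimes w^j$ and $\omega(\mathcal M^i_j)=M^i_j$; one writes $\delta=\vartheta(\omega)$ when they are given by the same matrix. $D=\mathrm{DiS}(B,C)\in\mathrm{End}(\mathbb K^{m+n}\otimes\mathbb K^{m+n})$ is the idempotent whose only non-zero entries are (with $\bar a=m+a$, $i,j,k,l\le m$, $a,b,c,d\le n$) $D^{ij}_{kl}=B^{ij}_{kl}$, $D^{\bar a\bar b}_{\bar c\bar d}=C^{ab}_{cd}$, $D^{i\bar a}_{i\bar a}=D^{\bar ai}_{\bar ai}=\frac12$, $D^{i\bar a}_{\bar ai}=D^{\bar ai}_{i\bar a}=-\frac12$.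 Then $\mathfrak X_B(\mathbb K)\otimes\mathfrak X_C(\mathbb K)=\mathfrak X_D(\mathbb K)$ (usual tensor product of graded algebras, total grading). For coactions $\delta$ on $\mathcal B$ and $\gamma$ on $\mathcal C$, let $\delta_{\mathcal A}\colon\mathcal B\to\mathcal A\otimes\mathcal B$, $\gamma_{\mathcal A}\colon\mathcal C\to\mathcal A\otimes\mathcal C$ be their compositions with $\mathcal A\circ\mathcal B\subset\mathcal A\otimes\mathcal B$, $\mathcal A\circ\mathcal C\subset\mathcal A\otimes\mathcal C$. The linear map $\mathcal B\otimes\mathcal C\to\mathcal A\otimes\mathcal B\otimes\mathcal C$ obtained as $\delta_{\mathcal A}\otimes\gamma_{\mathcal A}$ followed by the flip of the middle two factors and multiplication $\mathcal A\otimes\mathcal A\to\mathcal A$ takes values in $\mathcal A\circ(\mathcal B\otimes\mathcal C)$; denote the resulting graded map by $\delta\dotplus\gamma\colon\mathcal B\otimes\mathcal C\to\mathcal A\circ(\mathcal B\otimes\mathcal C)$. The direct sum of $\delta,\gamma$ (equivalently of $\omega,\nu$) is said to exist if $\delta\dotplus\gamma$ is an algebra homomorphism; then it is a coaction, and $\omega\dotplus\nu:=\vartheta^{-1}(\delta\dotplus\gamma)$. *)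

(* Defs.v *)
From HB Require Import structures.
From mathcomp Require Import all_boot all_algebra.
From mathcomp Require Import boolp classical_sets cardinality.
Set Implicit Arguments.
Unset Strict Implicit.
Unset Printing Implicit Defensive.

Import GRing.Theory.
Local Open Scope ring_scope.
Local Open Scope quotient_scope.

(* N-graded unital associative K-algebras.  A decomposition                   *)
(* A = \bigoplus_k A_k is given by the projections grproj k of A onto A_k     *)
(* along the other components.  The library's algType excludes the zero       *)
(* algebra; it could not carry a comonoid anyway, for want of a counit.       *)
HB.mixin Record isGrAlg (K : fieldType) A of GRing.Algebra K A := {
  grproj : nat -> A -> A;
  grproj_linear : forall k, linear (grproj k);
  grproj_orth : forall k l x,
    grproj k (grproj l x) = if k == l then grproj l x else 0;
  grproj_sum : forall x, exists d, x = \sum_(k < d) grproj k x;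
  grproj1 : grproj 0 1 = 1;
  grprojM : forall k l x y,
    grproj (k + l) (grproj k x * grproj l y) = grproj k x * grproj l y
}.

#[short(type="grAlgType")]
HB.structure Definition GrAlg (K : fieldType) :=
  {A of GRing.Algebra K A & isGrAlg K A}.

Definition homog (K : fieldType) (A : grAlgType K) k (x : A) := grproj k x = x.

Definition alg_hom (K : fieldType) (A B : grAlgType K) (f : A -> B) : Prop :=
  linear f /\ GRing.monoid_morphism f.

Definition gr_hom (K : fieldType) (A B : grAlgType K) (f : A -> B) : Prop :=
  alg_hom f /\ forall k x, homog k x -> homog k (f x).

HB.instance Definition _ (K : fieldType) (A : grAlgType K) k :=
  GRing.isLinear.Build K A A *:%R (grproj k) (@grproj_linear K A k).

Section GrAlgTheory.
Variables (K : fieldType) (A : grAlgType K).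
Implicit Types (x y : A) (k l : nat).

Lemma homog_proj k x : homog k (grproj k x).
Proof. by rewrite /homog grproj_orth eqxx. Qed.

Lemma homog0 k : homog k (0 : A). Proof. exact: raddf0. Qed.
Lemma homogD k x y : homog k x -> homog k y -> homog k (x + y).
Proof. by rewrite /homog raddfD /= => -> ->. Qed.
Lemma homogZ k c x : homog k x -> homog k (c *: x).
Proof. by rewrite /homog linearZ /= => ->. Qed.
Lemma homog_sum k (I : Type) (r : seq I) (P : pred I) (F : I -> A) :
  (forall i, P i -> homog k (F i)) -> homog k (\sum_(i <- r | P i) F i).
Proof. by move=> h; elim/big_ind: _ => //; [exact: homog0 | exact: homogD]. Qed.
Lemma homog1 : homog 0 (1 : A). Proof. exact: grproj1. Qed.
Lemma homogM k l x y : homog k x -> homog l y -> homog (k + l) (x * y).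
Proof. by move=> <- <-; exact: grprojM. Qed.
Lemma homog_neq k l x : homog l x -> k != l -> grproj k x = 0.
Proof. by move=> <- /negPf kl; rewrite grproj_orth kl. Qed.

End GrAlgTheory.

(* Tensor product of K-modules, by generators and relations.                  *)
Section Tensor.
Variables (K : fieldType) (U V : lmodType K).

Inductive tterm : Type :=
| TPure of U & V
| TZero
| TAdd of tterm & tterm
| TScale of K & tterm.

Inductive teq : tterm -> tterm -> Prop :=
| teq_refl s : teq s s
| teq_sym s t : teq s t -> teq t s
| teq_trans s t r : teq s t -> teq t r -> teq s r
| teq_add s s' t t' : teq s s' -> teq t t' -> teq (TAdd s t) (TAdd s' t')
| teq_scale c s s' : teq s s' -> teq (TScale c s) (TScale c s')
| teq_addA s t r : teq (TAdd s (TAdd t r)) (TAdd (TAdd s t) r)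
| teq_addC s t : teq (TAdd s t) (TAdd t s)
| teq_add0 s : teq (TAdd TZero s) s
| teq_addN s : teq (TAdd (TScale (-1) s) s) TZero
| teq_scaleA c d s : teq (TScale c (TScale d s)) (TScale (c * d) s)
| teq_scale1 s : teq (TScale 1 s) s
| teq_scaleDr c s t : teq (TScale c (TAdd s t)) (TAdd (TScale c s) (TScale c t))
| teq_scaleDl c d s : teq (TScale (c + d) s) (TAdd (TScale c s) (TScale d s))
| teq_pureDl u u' v : teq (TPure (u + u') v) (TAdd (TPure u v) (TPure u' v))
| teq_pureDr u v v' : teq (TPure u (v + v')) (TAdd (TPure u v) (TPure u v'))
| teq_pureZl c u v : teq (TPure (c *: u) v) (TScale c (TPure u v))
| teq_pureZr c u v : teq (TPure u (c *: v)) (TScale c (TPure u v)).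

HB.instance Definition _ := gen_eqMixin tterm.
HB.instance Definition _ := gen_choiceMixin tterm.

Definition teqb (s t : tterm) : bool := `[< teq s t >].
Fact teqb_refl : reflexive teqb.
Proof. by move=> s; apply/asboolP; exact: teq_refl. Qed.
Fact teqb_sym : symmetric teqb.
Proof. by move=> s t; apply/asboolP/asboolP => /teq_sym. Qed.
Fact teqb_trans : transitive teqb.
Proof.
move=> t s r /asboolP st /asboolP tr; apply/asboolP; exact: teq_trans st tr.
Qed.
Definition teq_equiv := EquivRel teqb teqb_refl teqb_sym teqb_trans.

Definition tens : Type := {eq_quot teq_equiv}.
HB.instance Definition _ := Choice.on tens.

Definition tcls (s : tterm) : tens := \pi_({eq_quot teq_equiv}) s.
Definition trep (t : tens) : tterm := repr (t : {eq_quot teq_equiv}).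

Lemma tclsP s t : tcls s = tcls t <-> teq s t.
Proof.
split=> [/eqquotP/asboolP //|st].
by apply/eqquotP/asboolP.
Qed.
Lemma trepK : cancel trep tcls. Proof. by move=> t; exact: reprK. Qed.
Lemma tcls_rep s : teq (trep (tcls s)) s. Proof. by apply/tclsP; rewrite trepK. Qed.

Definition tadd (s t : tens) : tens := tcls (TAdd (trep s) (trep t)).
Definition tscale c (s : tens) : tens := tcls (TScale c (trep s)).
Definition topp (s : tens) : tens := tscale (-1) s.
Definition tpure u v : tens := tcls (TPure u v).

Let taddE s t : tadd (tcls s) (tcls t) = tcls (TAdd s t).
Proof. by apply/tclsP/teq_add; exact: tcls_rep. Qed.
Let tscaleE c s : tscale c (tcls s) = tcls (TScale c s).
Proof. by apply/tclsP/teq_scale; exact: tcls_rep. Qed.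
Let tW (P : tens -> Prop) : (forall s, P (tcls s)) -> forall t, P t.
Proof. by move=> h t; rewrite -(trepK t). Qed.

Fact taddA : associative tadd.
Proof.
elim/tW => s; elim/tW => t; elim/tW => r; rewrite !taddE; apply/tclsP.
exact: teq_addA.
Qed.
Fact taddC : commutative tadd.
Proof.
by elim/tW => s; elim/tW => t; rewrite !taddE; apply/tclsP; exact: teq_addC.
Qed.
Fact tadd0 : left_id (tcls TZero) tadd.
Proof. by elim/tW => s; rewrite taddE; apply/tclsP; exact: teq_add0. Qed.
Fact taddN : left_inverse (tcls TZero) topp tadd.
Proof.
by elim/tW => s; rewrite /topp tscaleE taddE; apply/tclsP; exact: teq_addN.
Qed.
HB.instance Definition _ := GRing.isZmodule.Build tens taddA taddC tadd0 taddN.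

Fact tscaleA c d s : tscale c (tscale d s) = tscale (c * d) s.
Proof.
by elim/tW: s => s; rewrite !tscaleE; apply/tclsP; exact: teq_scaleA.
Qed.
Fact tscale1 : left_id 1 tscale.
Proof. by elim/tW => s; rewrite tscaleE; apply/tclsP; exact: teq_scale1. Qed.
Fact tscaleDr : right_distributive tscale +%R.
Proof.
move=> c; elim/tW => s; elim/tW => t.
rewrite /GRing.add /= taddE !tscaleE taddE; apply/tclsP.
exact: teq_scaleDr.
Qed.
Fact tscaleDl s : {morph tscale^~ s : c d / c + d}.
Proof.
elim/tW: s => s c d; rewrite [RHS]/GRing.add /= !tscaleE taddE; apply/tclsP.
exact: teq_scaleDl.
Qed.
HB.instance Definition _ :=
  GRing.Zmodule_isLmodule.Build K tens tscaleA tscale1 tscaleDr tscaleDl.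

Lemma tpureDl u u' v : tpure (u + u') v = tpure u v + tpure u' v.
Proof. by rewrite [RHS]taddE; apply/tclsP; exact: teq_pureDl. Qed.
Lemma tpureDr u v v' : tpure u (v + v') = tpure u v + tpure u v'.
Proof. by rewrite [RHS]taddE; apply/tclsP; exact: teq_pureDr. Qed.
Lemma tpureZl c u v : tpure (c *: u) v = c *: tpure u v.
Proof. by rewrite [RHS]tscaleE; apply/tclsP; exact: teq_pureZl. Qed.
Lemma tpureZr c u v : tpure u (c *: v) = c *: tpure u v.
Proof. by rewrite [RHS]tscaleE; apply/tclsP; exact: teq_pureZr. Qed.
Lemma tpure0l v : tpure 0 v = 0.
Proof. by rewrite -(scale0r (0 : U)) tpureZl scale0r. Qed.
Lemma tpure0r u : tpure u 0 = 0.
Proof. by rewrite -(scale0r (0 : V)) tpureZr scale0r. Qed.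
Lemma tpure_suml (I : Type) (r : seq I) (P : pred I) (F : I -> U) v :
  tpure (\sum_(i <- r | P i) F i) v = \sum_(i <- r | P i) tpure (F i) v.
Proof. exact: (big_morph (tpure^~ v) (fun x y => tpureDl x y v) (tpure0l v)). Qed.
Lemma tpure_sumr (I : Type) (r : seq I) (P : pred I) (F : I -> V) u :
  tpure u (\sum_(i <- r | P i) F i) = \sum_(i <- r | P i) tpure u (F i).
Proof. exact: (big_morph (tpure u) (tpureDr u) (tpure0r u)). Qed.

Lemma tens_ind (P : tens -> Prop) :
  (forall u v, P (tpure u v)) -> (forall s t, P s -> P t -> P (s + t)) ->
  forall t, P t.
Proof.
move=> Pp PD; elim/tW => s.
suff: forall c, P (c *: tcls s) by move=> /(_ 1); rewrite scale1r.
elim: s => [u v||s IHs t IHt|d s IHs] c.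
- by rewrite -[tcls _]/(tpure u v) -tpureZl.
- by rewrite -[tcls TZero]/(0 : tens) scaler0 -(tpure0l 0).
- rewrite -taddE; have := PD _ _ (IHs c) (IHt c); by rewrite -scalerDr.
- by rewrite -tscaleE -[tscale _ _]/(d *: tcls s) scalerA.
Qed.

Lemma tensP (t : tens) :
  exists s : seq (U * V), t = \sum_(p <- s) tpure p.1 p.2.
Proof.
elim/tens_ind: t => [u v|s t [ss ->] [st ->]].
  by exists [:: (u, v)]; rewrite big_seq1.
by exists (ss ++ st); rewrite big_cat.
Qed.

End Tensor.

Arguments tpure {K U V} u v.

Definition bilin (K : fieldType) (U V W : lmodType K) (f : U -> V -> W) : Prop :=
  (forall v, linear (f^~ v)) /\ (forall u, linear (f u)).

Section TensorLift.
Variables (K : fieldType) (U V W : lmodType K).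
Implicit Types (f : U -> V -> W).

Fixpoint teval f (s : tterm U V) : W :=
  match s with
  | TPure u v => f u v
  | TZero => 0
  | TAdd s t => teval f s + teval f t
  | TScale c s => c *: teval f s
  end.

(* The linear map induced by f; meaningful only when f is bilinear, see       *)
(* tlift_pure and tlift_linear.                                               *)
Definition tlift f (t : tens U V) : W := teval f (trep t).

Lemma teval_eq f s t : bilin f -> teq s t -> teval f s = teval f t.
Proof.
case=> [fl fr]; have fDl u u' v : f (u + u') v = f u v + f u' v.
  by have := fl v 1 u u'; rewrite !scale1r.
have fDr u v v' : f u (v + v') = f u v + f u v'.
  by have := fr u 1 v v'; rewrite !scale1r.
have f0l v : f 0 v = 0 by apply: (addrI (f 0 v)); rewrite -fDl !addr0.
have f0r u : f u 0 = 0 by apply: (addrI (f u 0)); rewrite -fDr !addr0.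
elim=> //=.
- by move=> s' t' r' _ -> _ ->.
- by move=> s1 s2 t1 t2 _ -> _ ->.
- by move=> c s1 s2 _ ->.
- by move=> *; rewrite addrA.
- by move=> *; rewrite addrC.
- by move=> *; rewrite add0r.
- by move=> *; rewrite scaleN1r addNr.
- by move=> *; rewrite scalerA.
- by move=> *; rewrite scale1r.
- by move=> *; rewrite scalerDr.
- by move=> *; rewrite scalerDl.
- by move=> c u v; have := fl v c u 0; rewrite !addr0 f0l addr0.
- by move=> c u v; have := fr u c v 0; rewrite !addr0 f0r addr0.
Qed.

Lemma tlift_pure f u v : bilin f -> tlift f (tpure u v) = f u v.
Proof. by move=> bf; rewrite /tlift (teval_eq bf (tcls_rep _)). Qed.

Lemma tlift_linear f : bilin f -> linear (tlift f).
Proof.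
move=> bf c s t; rewrite /tlift.
have e1 : teq (trep (c *: s + t)) (TAdd (TScale c (trep s)) (trep t)).
  apply: teq_trans (tcls_rep _) _; apply: teq_add; last exact: teq_refl.
  exact: tcls_rep.
by rewrite (teval_eq bf e1).
Qed.

Lemma linD (g : U -> W) : linear g -> {morph g : x y / x + y}.
Proof. by move=> lg x y; have := lg 1 x y; rewrite !scale1r. Qed.
Lemma lin0 (g : U -> W) : linear g -> g 0 = 0.
Proof. by move=> lg; apply: (addrI (g 0)); rewrite -linD // !addr0. Qed.
Lemma linZ (g : U -> W) c : linear g -> {morph g : x / c *: x}.
Proof. by move=> lg x; have := lg c x 0; rewrite (lin0 lg) !addr0. Qed.
Lemma lin_sum (g : U -> W) (I : Type) (r : seq I) (P : pred I) (F : I -> U) :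
  linear g -> g (\sum_(i <- r | P i) F i) = \sum_(i <- r | P i) g (F i).
Proof. by move=> lg; exact: (big_morph g (linD lg) (lin0 lg)). Qed.

Lemma tpure_bilin : bilin (@tpure K U V).
Proof.
by split=> [v c u u'|u c v v']; rewrite (tpureDl, tpureDr) (tpureZl, tpureZr).
Qed.

End TensorLift.

Lemma tens_ext (K : fieldType) (U V W : lmodType K) (f g : tens U V -> W) :
  linear f -> linear g -> (forall u v, f (tpure u v) = g (tpure u v)) -> f =1 g.
Proof.
move=> lf lg fg t; elim/tens_ind: t => // s t es et.
by rewrite (linD lf) (linD lg) es et.
Qed.

Section TensorMap.
Variables (K : fieldType) (U V U' V' : lmodType K).

Definition tmap (f : U -> U') (g : V -> V') : tens U V -> tens U' V' :=
  tlift (fun u v => tpure (f u) (g v)).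

Implicit Types (f : U -> U') (g : V -> V').

Lemma tmap_bilin f g : linear f -> linear g ->
  bilin (fun u v => tpure (f u) (g v)).
Proof.
move=> lf lg; split=> [v c u u'|u c v v'].
  by rewrite lf tpureDl tpureZl.
by rewrite lg tpureDr tpureZr.
Qed.
Lemma tmap_pure f g u v : linear f -> linear g ->
  tmap f g (tpure u v) = tpure (f u) (g v).
Proof. by move=> lf lg; rewrite /tmap tlift_pure //; exact: tmap_bilin. Qed.
Lemma tmap_linear f g : linear f -> linear g -> linear (tmap f g).
Proof. by move=> lf lg; apply: tlift_linear; exact: tmap_bilin. Qed.

End TensorMap.
(* A linear functional with value 1 at 1; it shows that tensor products of    *)
(* nonzero algebras are nonzero.                                              *)
Lemma exists_functional (K : fieldType) (A : algType K) :
  exists f : A -> K^o, linear f /\ f 1 = 1.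
Proof.
pose P (W : set A) :=
  (forall c x y, W x -> W y -> W (c *: x + y)) /\ ~ W 1.
have [F FP Ftot|W [[WL W1] Wmax]] := @Zorn_bigcup A P.
  split=> [c x y [X FX Xx] [Y FY Yy]|[X FX X1]]; last by have [_] := FP _ FX.
  have [XY|YX] := Ftot _ _ FX FY.
    by exists Y => //; have [h _] := FP _ FY; apply: h => //; exact: XY.
  by exists X => //; have [h _] := FP _ FX; apply: h => //; exact: YX.
have W0 : W 0.
  have [[x Wx]|nW] := pselect (exists x, W x).
    by have := WL (-1) _ _ Wx Wx; rewrite scaleN1r addNr.
  exfalso; apply: (Wmax (fun x => x = 0)).
    split; first by move=> x Wx; case: nW; exists x.
    by move=> h; case: nW; exists 0; apply: h.
  split=> [c x y -> ->|/eqP]; first by rewrite scaler0 addr0.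
  by rewrite oner_eq0.
have WD x y : W x -> W y -> W (x + y).
  by move=> Wx Wy; have := WL 1 _ _ Wx Wy; rewrite scale1r.
have WZ c x : W x -> W (c *: x).
  by move=> Wx; have := WL c _ _ Wx W0; rewrite addr0.
have key x : exists c : K^o, W (x - c *: 1).
  have [Wx|nWx] := pselect (W x); first by exists 0; rewrite scale0r subr0.
  pose V : set A := fun y => exists2 w, W w & exists d : K, y = w + d *: x.
  have V1 : V 1.
    apply: contrapT => nV1; apply: (Wmax V).
      split; first by move=> w Ww; exists w => //; exists 0; rewrite scale0r addr0.
      by move=> h; apply: nWx; apply: h; exists 0 => //; exists 1;
         rewrite scale1r add0r.
    split=> // c y z [w Ww [d ->]] [w' Ww' [d' ->]].
    exists (c *: w + w'); first exact: WL.
    exists (c * d + d').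
    by rewrite scalerDr scalerDl addrACA scalerA.
  case: V1 => w Ww [d e1].
  have d0 : d != 0.
    by apply/eqP => d0; apply: W1; rewrite e1 d0 scale0r addr0.
  exists d^-1; rewrite e1 scalerDr scalerA mulVf // scale1r opprD.
  by rewrite addrCA subrr addr0 -scaleNr; exact: WZ.
have uniq c d x : W (x - c *: 1) -> W (x - d *: 1) -> c = d.
  move=> Wc Wd; apply/eqP; rewrite -subr_eq0; apply/negPn/negP => cd.
  have : W ((c - d) *: 1).
    have := WL (-1) _ _ Wc Wd; rewrite scaleN1r opprB addrA subrK.
    by rewrite -scalerBl.
  by move=> /(WZ (c - d)^-1); rewrite scalerA mulVf // scale1r.
have [f fP] := choice key.
exists f; split=> [c x y|].
  apply: (uniq _ _ (c *: x + y)); first exact: fP.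
  have := WL c _ _ (fP x) (fP y).
  by rewrite scalerBr addrACA -opprD scalerDl scalerA.
by apply: (uniq _ _ 1); [exact: fP | rewrite scale1r subrr].
Qed.

(* The algebra structure (a ⊗ b)(a' ⊗ b') = aa' ⊗ bb'.                        *)
Section TensorAlgebra.
Variables (K : fieldType) (A B : algType K).

Definition tmul (s t : tens A B) : tens A B :=
  tlift (fun a b => tlift (fun a' b' => tpure (a * a') (b * b')) t) s.

Fact tmul_bilin1 (a : A) (b : B) :
  bilin (fun a' b' => tpure (a * a') (b * b')).
Proof.
split=> [v c u u'|u c v v'].
  by rewrite mulrDr -scalerAr tpureDl tpureZl.
by rewrite mulrDr -scalerAr tpureDr tpureZr.
Qed.
Fact tmul_bilin2 (t : tens A B) :
  bilin (fun a b => tlift (fun a' b' => tpure (a * a') (b * b')) t).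
Proof.
have l a b := tlift_linear (tmul_bilin1 a b).
split=> [v c u u'|u c v v']; elim/tens_ind: t => [a b|s t es et];
  rewrite ?(linD (l _ _)) ?es ?et ?scalerDr 1?addrACA //.
  by rewrite !(tlift_pure _ _ (tmul_bilin1 _ _)) mulrDl -scalerAl tpureDl tpureZl.
by rewrite !(tlift_pure _ _ (tmul_bilin1 _ _)) mulrDl -scalerAl tpureDr tpureZr.
Qed.

Fact tmul_linl t : linear (tmul^~ t).
Proof. exact: (tlift_linear (tmul_bilin2 t)). Qed.
Lemma tmul_pure a b a' b' :
  tmul (tpure a b) (tpure a' b') = tpure (a * a') (b * b').
Proof.
by rewrite /tmul (tlift_pure _ _ (tmul_bilin2 _))
           (tlift_pure _ _ (tmul_bilin1 _ _)).
Qed.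
Fact tmul_linr s : linear (tmul s).
Proof.
move=> c t t'; elim/tens_ind: s => [a b|s s' es es'].
  rewrite /tmul !(tlift_pure _ _ (tmul_bilin2 _)).
  exact: (tlift_linear (tmul_bilin1 a b)).
by rewrite !(linD (tmul_linl _)) es es' scalerDr addrACA.
Qed.
Fact tmulDl : left_distributive tmul +%R.
Proof. by move=> s s' t; exact: (linD (tmul_linl t)). Qed.
Fact tmulDr : right_distributive tmul +%R.
Proof. by move=> s t t'; exact: (linD (tmul_linr s)). Qed.
Fact tmulA : associative tmul.
Proof.
move=> s t r; elim/tens_ind: s => [a b|s s' es es']; last by rewrite !tmulDl es es'.
elim/tens_ind: t => [a' b'|t t' et et']; last by rewrite tmulDl !tmulDr tmulDl et et'.
elim/tens_ind: r => [a'' b''|r r' er er']; last by rewrite !tmulDr er er'.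
by rewrite !tmul_pure !mulrA.
Qed.
Fact tmul1l : left_id (tpure 1 1) tmul.
Proof.
move=> s; elim/tens_ind: s => [a b|s s' es es']; last by rewrite tmulDr es es'.
by rewrite tmul_pure !mul1r.
Qed.
Fact tmul1r : right_id (tpure 1 1) tmul.
Proof.
move=> s; elim/tens_ind: s => [a b|s s' es es']; last by rewrite tmulDl es es'.
by rewrite tmul_pure !mulr1.
Qed.
Fact tone_neq0 : tpure 1 1 != 0 :> tens A B.
Proof.
have [f [lf f1]] := exists_functional A; have [g [lg g1]] := exists_functional B.
pose h (a : A) (b : B) : K^o := f a * g b.
have bh : bilin h.
  split=> [v c u u'|u c v v'] /=; rewrite /h.
    by rewrite lf mulrDl -scalerAl.
  by rewrite lg mulrDr -scalerAr.
apply/eqP => /(congr1 (tlift h)).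
rewrite (tlift_pure _ _ bh) /h f1 g1 mulr1 (lin0 (tlift_linear bh)).
by move/eqP; rewrite oner_eq0.
Qed.
HB.instance Definition _ := GRing.Zmodule_isNzRing.Build (tens A B)
  tmulA tmul1l tmul1r tmulDl tmulDr tone_neq0.
Fact tmul_scalel c (s t : tens A B) : c *: (s * t) = (c *: s) * t.
Proof. exact: (esym (linZ c (tmul_linl t) s)). Qed.
Fact tmul_scaler c (s t : tens A B) : c *: (s * t) = s * (c *: t).
Proof. exact: (esym (linZ c (tmul_linr s) t)). Qed.
HB.instance Definition _ := GRing.Lmodule_isLalgebra.Build K (tens A B)
  tmul_scalel.
HB.instance Definition _ := GRing.Lalgebra_isAlgebra.Build K (tens A B)
  tmul_scaler.

Lemma tpureM (a a' : A) (b b' : B) :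
  tpure a b * tpure a' b' = tpure (a * a') (b * b') :> tens A B.
Proof. exact: tmul_pure. Qed.
Lemma tpure1 : tpure 1 1 = 1 :> tens A B. Proof. by []. Qed.

End TensorAlgebra.

(* The total grading (A ⊗ B)_k = \bigoplus_(i + j = k) A_i ⊗ B_j.             *)
Section TensorGrading.
Variables (K : fieldType) (A B : grAlgType K).

Definition tbiproj i j : tens A B -> tens A B := tmap (grproj i) (grproj j).
Definition tproj k (t : tens A B) : tens A B :=
  \sum_(i < k.+1) tbiproj i (k - i) t.

Lemma tbiproj_linear i j : linear (tbiproj i j).
Proof. by apply: tmap_linear; exact: grproj_linear. Qed.
HB.instance Definition _ i j :=
  GRing.isLinear.Build K (tens A B) (tens A B) *:%R (tbiproj i j)
    (tbiproj_linear i j).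
Lemma tbiproj_pure i j a b :
  tbiproj i j (tpure a b) = tpure (grproj i a) (grproj j b).
Proof. by rewrite [LHS]tmap_pure //; exact: grproj_linear. Qed.
Lemma tbiproj_orth i j i' j' t :
  tbiproj i j (tbiproj i' j' t) =
  if (i == i') && (j == j') then tbiproj i' j' t else 0.
Proof.
elim/tens_ind: t => [a b|s t es et]; last first.
  by rewrite !raddfD /= es et; case: ifP => //; rewrite addr0.
rewrite !tbiproj_pure !grproj_orth.
by case: eqP => _ /=; [case: eqP => _ //; rewrite tpure0r | rewrite tpure0l].
Qed.

Lemma grproj_sum_ge (E : grAlgType K) (x : E) : exists d, forall k, (d <= k)%N ->
  x = \sum_(i < k) grproj i x.
Proof.
have [d xd] := grproj_sum x; exists d => k dk.
rewrite {1}xd (big_ord_widen _ (fun i => grproj i x) dk) [RHS](bigID (fun i : 'I_k => (i < d)%N)) /=.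
rewrite [X in _ + X]big1 ?addr0 // => i; rewrite -leqNgt => di.
rewrite xd raddf_sum big1 //= => j _.
by rewrite grproj_orth gtn_eqF // (leq_trans _ di).
Qed.

Fact tproj_linear k : linear (tproj k).
Proof.
move=> c s t; rewrite /tproj scaler_sumr -big_split.
by apply: eq_bigr => i _; rewrite linearP.
Qed.
Fact tproj_orth k l t : tproj k (tproj l t) = if k == l then tproj l t else 0.
Proof.
rewrite /tproj; under eq_bigr do rewrite raddf_sum /=.
case: eqP => [->|/eqP kl].
  apply: eq_bigr => i _; rewrite (bigD1 i) //= tbiproj_orth !eqxx big1 ?addr0 //.
  by move=> j ji; rewrite tbiproj_orth eq_sym (inj_eq val_inj) (negPf ji).
rewrite big1 // => i _; rewrite big1 // => j _; rewrite tbiproj_orth.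
case: eqP => //= ij; case: eqP => //= e.
by case/eqP: kl; rewrite -(subnKC (ltn_ord i : (i <= k)%N)) e ij subnKC //
  -ltnS.
Qed.
Lemma tbiproj_sum t : exists d, forall k, (d <= k)%N ->
  t = \sum_(i < k) \sum_(j < k) tbiproj i j t.
Proof.
elim/tens_ind: t => [a b|s t [d es] [e et]].
  have [d hd] := grproj_sum_ge a; have [e he] := grproj_sum_ge b.
  exists (maxn d e) => k; rewrite geq_max => /andP[dk ek].
  rewrite {1}(hd k dk) tpure_suml; apply: eq_bigr => i _.
  rewrite {1}(he k ek) tpure_sumr; apply: eq_bigr => j _.
  by rewrite tbiproj_pure.
exists (maxn d e) => k; rewrite geq_max => /andP[dk ek].
rewrite {1}(es k dk) {1}(et k ek) -big_split; apply: eq_bigr => i _ /=.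
by rewrite -big_split; apply: eq_bigr => j _ /=; rewrite raddfD.
Qed.
Lemma tproj_bi k i j t :
  tproj k (tbiproj i j t) = if (i + j == k)%N then tbiproj i j t else 0.
Proof.
rewrite /tproj; under eq_bigr do rewrite tbiproj_orth.
case: eqP => [<-|ijk].
  have il : (i < (i + j).+1)%N by rewrite ltnS leq_addr.
  rewrite (bigD1 (Ordinal il)) //= addKn !eqxx big1 ?addr0 //.
  by move=> i'; rewrite -(inj_eq val_inj) /= => /negPf ->.
rewrite big1 // => i' _; case: eqP => //= e1; case: eqP => //= e2.
by case: ijk; rewrite -e1 -e2 subnKC // -ltnS.
Qed.
Fact tproj_sum t : exists d, t = \sum_(k < d) tproj k t.
Proof.
have [d hd] := tbiproj_sum t; exists (d + d)%N.
have {1}-> := hd d (leqnn d).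
transitivity (\sum_(k < d + d) tproj k (\sum_(i < d) \sum_(j < d) tbiproj i j t));
  last by rewrite -hd.
under [RHS]eq_bigr do
  rewrite (lin_sum _ _ _ (tproj_linear _)) /=.
rewrite [RHS]exchange_big; apply: eq_bigr => i _ /=.
under [RHS]eq_bigr do
  rewrite (lin_sum _ _ _ (tproj_linear _)) /=.
rewrite [RHS]exchange_big; apply: eq_bigr => j _ /=.
under [RHS]eq_bigr do rewrite tproj_bi.
have ijl : (i + j < d + d)%N.
  by apply: (@leq_trans (d + j)); rewrite ?ltn_add2r ?leq_add2l // ltnW.
rewrite (bigD1 (Ordinal ijl)) //= eqxx big1 ?addr0 //.
by move=> k; rewrite -(inj_eq val_inj) /= eq_sym => /negPf ->.
Qed.
Lemma tproj_pure k i j a b : homog i a -> homog j b ->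
  tproj k (tpure a b) = if (i + j == k)%N then tpure a b else 0.
Proof.
by move=> ha hb; rewrite -[in LHS]ha -[in LHS]hb -tbiproj_pure tproj_bi
  tbiproj_pure ha hb.
Qed.
Fact tproj1 : tproj 0 1 = 1.
Proof. by rewrite -tpure1 (@tproj_pure 0 0 0) //; exact: homog1. Qed.

Lemma tprojP k t : exists s : seq (nat * (A * B)),
  tproj k t = \sum_(p <- s | (p.1 <= k)%N)
     tpure (grproj p.1 p.2.1) (grproj (k - p.1) p.2.2).
Proof.
elim/tens_ind: t => [a b|t t' [s es] [s' es']].
  exists [seq (i, (a, b)) | i <- iota 0 k.+1].
  rewrite big_map /tproj -(big_mkord xpredT (fun i => tbiproj i (k - i) (tpure a b))).
  rewrite /index_iota subn0 [RHS]big_seq_cond [LHS]big_seq_cond.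
  apply: eq_big => [i|i _]; last by rewrite tbiproj_pure.
  by rewrite mem_iota /= add0n ltnS; case: (_ <= _)%N.
by exists (s ++ s'); rewrite (linD (tproj_linear k)) es es' big_cat.
Qed.
Fact tprojM k l s t :
  tproj (k + l) (tproj k s * tproj l t) = tproj k s * tproj l t.
Proof.
have [ss ->] := tprojP k s; have [st ->] := tprojP l t.
rewrite mulr_suml (lin_sum _ _ _ (tproj_linear _)); apply: eq_bigr => p pk.
rewrite mulr_sumr (lin_sum _ _ _ (tproj_linear _)); apply: eq_bigr => q ql.
rewrite tpureM.
rewrite (tproj_pure _ (homogM (homog_proj p.1 p.2.1) (homog_proj q.1 q.2.1))
  (homogM (homog_proj (k - p.1) p.2.2) (homog_proj (l - q.1) q.2.2))).
by rewrite addnACA !subnKC // eqxx.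
Qed.
HB.instance Definition _ := isGrAlg.Build K (tens A B)
  tproj_linear tproj_orth tproj_sum tproj1 tprojM.

Lemma homog_tpure i j (a : A) (b : B) : homog i a -> homog j b ->
  homog (i + j) (tpure a b : tens A B).
Proof.
by move=> ha hb; rewrite /homog [LHS](tproj_pure _ ha hb) eqxx.
Qed.

End TensorGrading.

(* Manin product: the subalgebra of A ⊗ B consisting of the finite sums of    *)
(* elements a ⊗ b with a and b homogeneous of the same degree.                *)
Section Manin.
Variables (K : fieldType) (A B : grAlgType K).

Definition manin_pred : pred (tens A B) := fun t =>
  `[< exists s : seq (nat * (A * B)),
        t = \sum_(p <- s) tpure (grproj p.1 p.2.1) (grproj p.1 p.2.2) >].

Record manin := Manin { manin_val : tens A B; _ : manin_pred manin_val }.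
HB.instance Definition _ := [isSub for manin_val].
HB.instance Definition _ := [Choice of manin by <:].

Lemma manin_pure k a b : homog k a -> homog k b -> manin_pred (tpure a b).
Proof.
by move=> ha hb; apply/asboolP; exists [:: (k, (a, b))]; rewrite big_seq1 ha hb.
Qed.
Lemma manin0 : manin_pred 0.
Proof. by apply/asboolP; exists [::]; rewrite big_nil. Qed.
Lemma maninD s t : manin_pred s -> manin_pred t -> manin_pred (s + t).
Proof.
move=> /asboolP[r ->] /asboolP[r' ->]; apply/asboolP.
by exists (r ++ r'); rewrite big_cat.
Qed.
Lemma manin_sum (I : Type) (r : seq I) (P : pred I) (F : I -> tens A B) :
  (forall i, P i -> manin_pred (F i)) -> manin_pred (\sum_(i <- r | P i) F i).
Proof. by move=> h; elim/big_ind: _ => //; [exact: manin0 | exact: maninD]. Qed.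
Lemma maninZ c t : manin_pred t -> manin_pred (c *: t).
Proof.
move=> /asboolP[r ->]; rewrite scaler_sumr; apply: manin_sum => p _.
rewrite -tpureZl; apply: (manin_pure (k := p.1)); last exact: homog_proj.
by apply: homogZ; exact: homog_proj.
Qed.
Lemma maninM s t : manin_pred s -> manin_pred t -> manin_pred (s * t).
Proof.
move=> /asboolP[r ->] /asboolP[r' ->]; rewrite mulr_suml; apply: manin_sum => p _.
rewrite mulr_sumr; apply: manin_sum => q _; rewrite tpureM.
by apply: (manin_pure (k := (p.1 + q.1)%N)); apply: homogM; exact: homog_proj.
Qed.
Lemma manin1 : manin_pred 1.
Proof. by rewrite -tpure1; apply: (manin_pure (k := 0%N)); exact: homog1. Qed.
Fact manin_subring_closed : subring_closed manin_pred.
Proof.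
split=> [|s t hs ht|s t hs ht]; [exact: manin1 | | exact: maninM].
by apply: maninD => //; rewrite -scaleN1r; exact: maninZ.
Qed.
Fact manin_submod_closed : submod_closed manin_pred.
Proof.
split=> [|c s t hs ht]; first exact: manin0.
by apply: maninD => //; exact: maninZ.
Qed.

HB.instance Definition _ :=
  GRing.SubChoice_isSubNzRing.Build (tens A B) manin_pred manin
    manin_subring_closed.
HB.instance Definition _ :=
  GRing.SubZmodule_isSubLmodule.Build K (tens A B) manin_pred manin
    manin_submod_closed.
HB.instance Definition _ :=
  GRing.SubNzRing_SubLmodule_isSubLalgebra.Build K (tens A B) manin_pred manin.
HB.instance Definition _ :=
  GRing.SubLalgebra_isSubAlgebra.Build K (tens A B) manin_pred manin.

Lemma manin_inj : injective manin_val. Proof. exact: val_inj. Qed.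
Lemma manin_valP x : manin_pred (manin_val x). Proof. exact: valP. Qed.

Fact mproj_subproof k (x : manin) : manin_pred (tbiproj k k (manin_val x)).
Proof.
have /asboolP[s ->] := manin_valP x; rewrite raddf_sum; apply: manin_sum => p _ /=.
by rewrite tbiproj_pure; apply: (manin_pure (k := k)); exact: homog_proj.
Qed.
(* (A ∘ B)_k = A_k ⊗ B_k *)
Definition mproj k (x : manin) : manin := Manin (mproj_subproof k x).

Fact mproj_linear k : linear (mproj k).
Proof. by move=> c x y; apply: val_inj; rewrite /= linearP. Qed.
Fact mproj_orth k l x : mproj k (mproj l x) = if k == l then mproj l x else 0.
Proof.
apply: val_inj; rewrite /= tbiproj_orth andbb.
by case: ifP => _.
Qed.
Fact mproj_sum x : exists d, x = \sum_(k < d) mproj k x.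
Proof.
have [s ex] : exists s : seq (nat * (A * B)), manin_val x =
  \sum_(p <- s) tpure (grproj p.1 p.2.1) (grproj p.1 p.2.2).
  exact/asboolP/manin_valP.
exists (\max_(p <- s) p.1).+1; apply: val_inj; rewrite raddf_sum /= ex.
under [RHS]eq_bigr do rewrite raddf_sum /=.
rewrite [RHS]exchange_big /= [LHS]big_seq [RHS]big_seq; apply: eq_bigr => p ps.
have pl : (p.1 < (\max_(p <- s) p.1).+1)%N by rewrite ltnS; exact: leq_bigmax_seq.
rewrite (bigD1 (Ordinal pl)) //= tbiproj_pure !homog_proj big1 ?addr0 // => k.
rewrite -(inj_eq val_inj) /= tbiproj_pure grproj_orth => /negPf ->.
by rewrite tpure0l.
Qed.
Fact mproj1 : mproj 0 1 = 1.
Proof. by apply: val_inj; rewrite /= -tpure1 tbiproj_pure !grproj1. Qed.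
Fact mprojM k l x y : mproj (k + l) (mproj k x * mproj l y) = mproj k x * mproj l y.
Proof.
apply: val_inj => /=.
have /asboolP[s ->] := manin_valP x; have /asboolP[s' ->] := manin_valP y.
rewrite !raddf_sum mulr_suml raddf_sum; apply: eq_bigr => p _ /=.
rewrite mulr_sumr raddf_sum; apply: eq_bigr => q _ /=.
by rewrite !tbiproj_pure tpureM tbiproj_pure; congr tpure; exact: grprojM.
Qed.
HB.instance Definition _ := isGrAlg.Build K manin
  mproj_linear mproj_orth mproj_sum mproj1 mprojM.

Lemma homog_manin k (x : manin) :
  homog k x <-> tbiproj k k (manin_val x) = manin_val x.
Proof.
by split=> [/(congr1 manin_val)//|h]; apply: val_inj.
Qed.

End Manin.
(* The unit object K[u], graded by the degree in u.                           *)
Section PolyGrading.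
Variable K : fieldType.
Implicit Types p q : {poly K}.

Definition pproj k p : {poly K} := p`_k *: 'X^k.
Fact pproj_linear k : linear (pproj k).
Proof. by move=> c p q; rewrite /pproj coefD coefZ scalerDl scalerA. Qed.
Fact pproj_orth k l p : pproj k (pproj l p) = if k == l then pproj l p else 0.
Proof.
rewrite /pproj coefZ coefXn; case: eqP => [->|_]; first by rewrite mulr1.
by rewrite mulr0 scale0r.
Qed.
Fact pproj_sum p : exists d, p = \sum_(k < d) pproj k p.
Proof. by exists (size p); rewrite -[LHS]coefK poly_def. Qed.
Fact pproj1 : pproj 0 1 = 1.
Proof. by rewrite /pproj coef1 expr0 scale1r. Qed.
Fact pprojM k l p q : pproj (k + l) (pproj k p * pproj l q) = pproj k p * pproj l q.
Proof.
rewrite /pproj -scalerAl -scalerAr -exprD scalerA coefZ coefXn eqxx mulr1.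
by [].
Qed.
HB.instance Definition _ := isGrAlg.Build K {poly K}
  pproj_linear pproj_orth pproj_sum pproj1 pprojM.
End PolyGrading.

(* The quadratic algebra with generators X in degree 1 and the relations      *)
(* \sum_(x, y) rel j x y * (x * y) = 0 for j in J: terms in the generators    *)
(* modulo the congruence generated by the K-algebra axioms and the relations. *)
Section Quad.
Variables (K : fieldType) (X : finType) (J : Type) (rel : J -> X -> X -> K).

Inductive qterm : Type :=
| QGen of X
| QConst of K
| QAdd of qterm & qterm
| QMul of qterm & qterm.

Definition qrelation (j : J) : qterm :=
  \big[QAdd/QConst 0]_(x : X) \big[QAdd/QConst 0]_(y : X)
     QMul (QConst (rel j x y)) (QMul (QGen x) (QGen y)).

Inductive qeq : qterm -> qterm -> Prop :=
| qeq_refl s : qeq s s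
| qeq_sym s t : qeq s t -> qeq t s
| qeq_trans s t r : qeq s t -> qeq t r -> qeq s r
| qeq_add s s' t t' : qeq s s' -> qeq t t' -> qeq (QAdd s t) (QAdd s' t')
| qeq_mul s s' t t' : qeq s s' -> qeq t t' -> qeq (QMul s t) (QMul s' t')
| qeq_addA s t r : qeq (QAdd s (QAdd t r)) (QAdd (QAdd s t) r)
| qeq_addC s t : qeq (QAdd s t) (QAdd t s)
| qeq_add0 s : qeq (QAdd (QConst 0) s) s
| qeq_addN s : qeq (QAdd (QMul (QConst (-1)) s) s) (QConst 0)
| qeq_mulA s t r : qeq (QMul s (QMul t r)) (QMul (QMul s t) r)
| qeq_mul1l s : qeq (QMul (QConst 1) s) s
| qeq_mulDl s t r : qeq (QMul (QAdd s t) r) (QAdd (QMul s r) (QMul t r))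
| qeq_mulDr s t r : qeq (QMul s (QAdd t r)) (QAdd (QMul s t) (QMul s r))
| qeq_constD c d : qeq (QConst (c + d)) (QAdd (QConst c) (QConst d))
| qeq_constM c d : qeq (QConst (c * d)) (QMul (QConst c) (QConst d))
| qeq_constC c s : qeq (QMul (QConst c) s) (QMul s (QConst c))
| qeq_rel j : qeq (qrelation j) (QConst 0).

HB.instance Definition _ := gen_eqMixin qterm.
HB.instance Definition _ := gen_choiceMixin qterm.

Definition qeqb (s t : qterm) : bool := `[< qeq s t >].
Fact qeqb_refl : reflexive qeqb.
Proof. by move=> s; apply/asboolP; exact: qeq_refl. Qed.
Fact qeqb_sym : symmetric qeqb.
Proof. by move=> s t; apply/asboolP/asboolP => /qeq_sym. Qed.
Fact qeqb_trans : transitive qeqb.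
Proof.
move=> t s r /asboolP st /asboolP tr; apply/asboolP; exact: qeq_trans st tr.
Qed.
Definition qeq_equiv := EquivRel qeqb qeqb_refl qeqb_sym qeqb_trans.

Definition quad : Type := {eq_quot qeq_equiv}.
HB.instance Definition _ := Choice.on quad.

Definition qcls (s : qterm) : quad := \pi_({eq_quot qeq_equiv}) s.
Definition qrep (t : quad) : qterm := repr (t : {eq_quot qeq_equiv}).

Lemma qclsP s t : qcls s = qcls t <-> qeq s t.
Proof.
split=> [/eqquotP/asboolP //|st].
by apply/eqquotP/asboolP.
Qed.
Lemma qrepK : cancel qrep qcls. Proof. by move=> t; exact: reprK. Qed.
Lemma qcls_rep s : qeq (qrep (qcls s)) s.
Proof. by apply/qclsP; rewrite qrepK. Qed.
Lemma qclsW (P : quad -> Prop) : (forall s, P (qcls s)) -> forall t, P t.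
Proof. by move=> h t; rewrite -(qrepK t). Qed.

Fixpoint qeval (S : algType K) (g : X -> S) (s : qterm) : S :=
  match s with
  | QGen x => g x
  | QConst c => c%:A
  | QAdd s t => qeval g s + qeval g t
  | QMul s t => qeval g s * qeval g t
  end.

Definition qsat (S : algType K) (g : X -> S) : Prop :=
  forall j, \sum_x \sum_y rel j x y *: (g x * g y) = 0.

Lemma qeval_rel (S : algType K) (g : X -> S) j :
  qeval g (qrelation j) = \sum_x \sum_y rel j x y *: (g x * g y).
Proof.
have e0 : qeval g (QConst 0) = 0 by rewrite /= scale0r.
rewrite (big_morph (qeval g) (fun s t => erefl) e0); apply: eq_bigr => x _.
rewrite (big_morph (qeval g) (fun s t => erefl) e0); apply: eq_bigr => y _.
by rewrite /= mulr_algl.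
Qed.

Lemma qeval_eq (S : algType K) (g : X -> S) s t :
  qsat g -> qeq s t -> qeval g s = qeval g t.
Proof.
move=> hg; elim=> //=.
- by move=> s' t' r' _ -> _ ->.
- by move=> s1 s2 t1 t2 _ -> _ ->.
- by move=> s1 s2 t1 t2 _ -> _ ->.
- by move=> *; rewrite addrA.
- by move=> *; rewrite addrC.
- by move=> *; rewrite scale0r add0r.
- by move=> *; rewrite scaleN1r mulN1r addNr scale0r.
- by move=> *; rewrite mulrA.
- by move=> *; rewrite scale1r mul1r.
- by move=> *; rewrite mulrDl.
- by move=> *; rewrite mulrDr.
- by move=> *; rewrite scalerDl.
- by move=> *; rewrite mulr_algl scalerA.
- by move=> *; rewrite mulr_algl mulr_algr.
- by move=> j; rewrite qeval_rel hg scale0r.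
Qed.

Definition qadd (s t : quad) : quad := qcls (QAdd (qrep s) (qrep t)).
Definition qmul (s t : quad) : quad := qcls (QMul (qrep s) (qrep t)).
Definition qopp (s : quad) : quad := qmul (qcls (QConst (-1))) s.
Definition qgen (x : X) : quad := qcls (QGen x).

Let qaddE s t : qadd (qcls s) (qcls t) = qcls (QAdd s t).
Proof. by apply/qclsP/qeq_add; exact: qcls_rep. Qed.
Let qmulE s t : qmul (qcls s) (qcls t) = qcls (QMul s t).
Proof. by apply/qclsP/qeq_mul; exact: qcls_rep. Qed.

Fact qaddA : associative qadd.
Proof.
elim/qclsW => s; elim/qclsW => t; elim/qclsW => r; rewrite !qaddE; apply/qclsP.
exact: qeq_addA.
Qed.
Fact qaddC : commutative qadd.
Proof.
by elim/qclsW => s; elim/qclsW => t; rewrite !qaddE; apply/qclsP; exact: qeq_addC.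
Qed.
Fact qadd0 : left_id (qcls (QConst 0)) qadd.
Proof. by elim/qclsW => s; rewrite qaddE; apply/qclsP; exact: qeq_add0. Qed.
Fact qaddN : left_inverse (qcls (QConst 0)) qopp qadd.
Proof.
by elim/qclsW => s; rewrite /qopp qmulE qaddE; apply/qclsP; exact: qeq_addN.
Qed.
HB.instance Definition _ := GRing.isZmodule.Build quad qaddA qaddC qadd0 qaddN.

Fact qmulA : associative qmul.
Proof.
elim/qclsW => s; elim/qclsW => t; elim/qclsW => r; rewrite !qmulE; apply/qclsP.
exact: qeq_mulA.
Qed.
Fact qmul1l : left_id (qcls (QConst 1)) qmul.
Proof. by elim/qclsW => s; rewrite qmulE; apply/qclsP; exact: qeq_mul1l. Qed.
Fact qmul1r : right_id (qcls (QConst 1)) qmul.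
Proof.
elim/qclsW => s; rewrite qmulE; apply/qclsP.
exact: qeq_trans (qeq_sym (qeq_constC _ _)) (qeq_mul1l _).
Qed.
Fact qmulDl : left_distributive qmul +%R.
Proof.
elim/qclsW => s; elim/qclsW => t; elim/qclsW => r.
rewrite /GRing.add /= qaddE !qmulE qaddE; apply/qclsP; exact: qeq_mulDl.
Qed.
Fact qmulDr : right_distributive qmul +%R.
Proof.
elim/qclsW => s; elim/qclsW => t; elim/qclsW => r.
rewrite /GRing.add /= qaddE !qmulE qaddE; apply/qclsP; exact: qeq_mulDr.
Qed.
Fact qone_neq0 : qcls (QConst 1) != 0.
Proof.
apply/eqP => /qclsP /(@qeval_eq K^o (fun=> 0)).
have h : qsat (S := K^o) (fun=> 0).
  by move=> j; rewrite big1 // => x _; rewrite big1 // => y _; rewrite mul0r scaler0.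
move=> /(_ h) /= /eqP.
by rewrite scale0r scale1r oner_eq0.
Qed.
HB.instance Definition _ := GRing.Zmodule_isNzRing.Build quad
  qmulA qmul1l qmul1r qmulDl qmulDr qone_neq0.

Definition qscale (c : K) (s : quad) : quad := qcls (QConst c) * s.
Fact qscaleA c d s : qscale c (qscale d s) = qscale (c * d) s.
Proof.
rewrite /qscale mulrA; congr (_ * _).
by rewrite [LHS]qmulE; apply/qclsP/qeq_sym; exact: qeq_constM.
Qed.
Fact qscale1 : left_id 1 qscale.
Proof. by move=> s; rewrite /qscale mul1r. Qed.
Fact qscaleDr : right_distributive qscale +%R.
Proof. by move=> c s t; rewrite /qscale mulrDr. Qed.
Fact qscaleDl s : {morph qscale^~ s : c d / c + d}.
Proof.
move=> c d; rewrite /qscale -mulrDl; congr (_ * _).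
by rewrite [RHS]qaddE; apply/qclsP; exact: qeq_constD.
Qed.
HB.instance Definition _ :=
  GRing.Zmodule_isLmodule.Build K quad qscaleA qscale1 qscaleDr qscaleDl.
Fact qscaleAl c (s t : quad) : c *: (s * t) = (c *: s) * t.
Proof. exact: mulrA. Qed.
Fact qscaleAr c (s t : quad) : c *: (s * t) = s * (c *: t).
Proof.
rewrite [LHS]mulrA [RHS]mulrA; congr (_ * _).
by elim/qclsW: s => s; rewrite [LHS]qmulE [RHS]qmulE; apply/qclsP; exact: qeq_constC.
Qed.
HB.instance Definition _ := GRing.Lmodule_isLalgebra.Build K quad qscaleAl.
HB.instance Definition _ := GRing.Lalgebra_isAlgebra.Build K quad qscaleAr.

Lemma qclsD s t : qcls (QAdd s t) = qcls s + qcls t.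
Proof. by rewrite [RHS]qaddE. Qed.
Lemma qclsM s t : qcls (QMul s t) = qcls s * qcls t.
Proof. by rewrite [RHS]qmulE. Qed.
Lemma qclsC c : qcls (QConst c) = c%:A.
Proof. by rewrite -[LHS]mulr1. Qed.

Lemma qgen_rel : qsat qgen.
Proof.
have e s : qeval qgen s = qcls s.
  by elim: s => [x|c|s es t et|s es t et] /=;
    rewrite ?qclsD ?qclsM ?qclsC ?es ?et.
move=> j; rewrite -qeval_rel e; apply/qclsP; exact: qeq_rel.
Qed.

Lemma quad_ind (P : quad -> Prop) :
  (forall x, P (qgen x)) -> (forall c, P c%:A) ->
  (forall s t, P s -> P t -> P (s + t)) ->
  (forall s t, P s -> P t -> P (s * t)) -> forall t, P t.
Proof.
move=> Pg Pc PD PM; elim/qclsW; elim=> [x|c|s hs t ht|s hs t ht].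
- exact: Pg.
- by rewrite qclsC.
- by rewrite qclsD; exact: PD.
- by rewrite qclsM; exact: PM.
Qed.

(* The algebra map with values g on the generators; meaningful only when g    *)
(* satisfies the relations, see qlift_gen and qlift_hom.                      *)
Definition qlift (S : algType K) (g : X -> S) (t : quad) : S := qeval g (qrep t).

Lemma qlift_cls (S : algType K) (g : X -> S) s :
  qsat g -> qlift g (qcls s) = qeval g s.
Proof. by move=> hg; apply: qeval_eq => //; exact: qcls_rep. Qed.
Lemma qlift_gen (S : algType K) (g : X -> S) x : qsat g -> qlift g (qgen x) = g x.
Proof. by move=> hg; rewrite qlift_cls. Qed.
Lemma qlift_linear (S : algType K) (g : X -> S) : qsat g -> linear (qlift g).
Proof.
move=> hg c; elim/qclsW => s; elim/qclsW => t.
have -> : c *: qcls s + qcls t = qcls (QAdd (QMul (QConst c) s) t).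
  by rewrite qclsD qclsM qclsC mulr_algl.
by rewrite !qlift_cls //= mulr_algl.
Qed.
Lemma qlift_monoid (S : algType K) (g : X -> S) :
  qsat g -> GRing.monoid_morphism (qlift g).
Proof.
move=> hg; split; first by rewrite [LHS]qlift_cls //= scale1r.
by elim/qclsW => s; elim/qclsW => t; rewrite -qclsM !qlift_cls.
Qed.

End Quad.

Arguments qgen {K X J} rel x.
Arguments qsat {K X J} rel {S} g.
Arguments qlift {K X J} rel {S} g t.

Section Convolution.
Variables (A : pzRingType).
Implicit Types (a b c : nat -> A).

Definition conv a b : nat -> A := fun k => \sum_(i < k.+1) a i * b (k - i)%N.
Definition dl (i : nat) (x : A) : nat -> A := fun k => if k == i then x else 0.

Lemma conv_rev a b k : conv a b k = \sum_(i < k.+1) a (k - i)%N * b i.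
Proof.
rewrite /conv (reindex_inj rev_ord_inj) /=.
by apply: eq_bigr => i _; rewrite (sub_ordK i).
Qed.
Lemma convA a b c : conv a (conv b c) = conv (conv a b) c.
Proof.
apply/funext => i; rewrite conv_rev /conv.
under eq_bigr do rewrite -/(conv b c _).
rewrite -(conv_rev a (conv b c)) /conv [RHS]/=.
pose coef3 j k := a j * (b (i - j - k)%N * c k).
transitivity (\sum_(j < i.+1) \sum_(k < i.+1 | (k <= i - j)%N) coef3 j k).
  apply: eq_bigr => /= j _; rewrite -/(conv b c _) conv_rev big_distrr /=.
  by rewrite (big_ord_narrow_leq (leq_subr _ _)).
under [RHS]eq_bigr do rewrite -/(conv a b _).
rewrite -/(conv (conv a b) c i) [RHS]conv_rev.
rewrite (exchange_big_dep predT) //=; apply: eq_bigr => k _.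
transitivity (\sum_(j < i.+1 | (j <= i - k)%N) coef3 j k).
  apply: eq_bigl => j; rewrite -ltnS -(ltnS j) -!subSn ?leq_ord //.
  by rewrite -subn_gt0 -(subn_gt0 j) -!subnDA addnC.
rewrite (big_ord_narrow_leq (leq_subr _ _)) /conv big_distrl /=.
by apply: eq_bigr => j _; rewrite /coef3 -!subnDA addnC mulrA.
Qed.
Lemma convDl a b c :
  conv (fun k => a k + b k) c = (fun k => conv a c k + conv b c k).
Proof.
apply/funext => k; rewrite /conv -big_split.
by apply: eq_bigr => i _; rewrite mulrDl.
Qed.
Lemma convDr a b c :
  conv a (fun k => b k + c k) = (fun k => conv a b k + conv a c k).
Proof.
apply/funext => k; rewrite /conv -big_split.
by apply: eq_bigr => i _; rewrite mulrDr.
Qed.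
Lemma conv_dl0l x b : conv (dl 0 x) b = (fun k => x * b k).
Proof.
apply/funext => k; rewrite /conv big_ord_recl /dl /= subn0 big1 ?addr0 // => i _.
by rewrite mul0r.
Qed.
Lemma conv_dl0r x a : conv a (dl 0 x) = (fun k => a k * x).
Proof.
apply/funext => k; rewrite conv_rev big_ord_recl /dl /= subn0 big1 ?addr0 // => i _.
by rewrite mulr0.
Qed.
Lemma conv_dl i j x y : conv (dl i x) (dl j y) = dl (i + j) (x * y).
Proof.
apply/funext => k; rewrite /conv /dl.
case: eqP => [->|kij].
  have il : (i < (i + j).+1)%N by rewrite ltnS leq_addr.
  rewrite (bigD1 (Ordinal il)) //= addKn !eqxx big1 ?addr0 //.
  by move=> i'; rewrite -(inj_eq val_inj) /= => /negPf ->; rewrite mul0r.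
rewrite big1 // => i' _; case: eqP => [e1|_]; last by rewrite mul0r.
case: eqP => [e2|_]; last by rewrite mulr0.
by case: kij; rewrite -e1 -e2 subnKC // -ltnS.
Qed.
End Convolution.

Section QuadGrading.
Variables (K : fieldType) (X : finType) (J : Type) (rel : J -> X -> X -> K).
Local Notation quad := (quad rel).

Fixpoint qcomp (s : qterm K X) : nat -> quad :=
  match s with
  | QGen x => dl 1 (qgen rel x)
  | QConst c => dl 0 c%:A
  | QAdd s t => fun k => qcomp s k + qcomp t k
  | QMul s t => conv (qcomp s) (qcomp t)
  end.

Lemma qcomp_rel j : qcomp (qrelation rel j) = dl 2 0.
Proof.
apply/funext => k.
transitivity (dl 2 (\sum_x \sum_y rel j x y *: (qgen rel x * qgen rel y)) k);
  last by rewrite qgen_rel.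
have e0 : qcomp (QConst X 0) k = 0 by rewrite /= /dl scale0r if_same.
rewrite /qrelation (big_morph (qcomp^~ k) (fun s t => erefl) e0).
transitivity (\sum_x \sum_y dl 2 (rel j x y *: (qgen rel x * qgen rel y)) k).
  apply: eq_bigr => x _.
  rewrite (big_morph (qcomp^~ k) (fun s t => erefl) e0); apply: eq_bigr => y _.
  by rewrite /= !conv_dl mulr_algl.
rewrite /dl; case: eqP => // _.
by rewrite big1 // => x _; rewrite big1.
Qed.

Lemma qcomp_eq s t : qeq rel s t -> qcomp s = qcomp t.
Proof.
elim=> //=.
- by move=> s' t' r' _ -> _ ->.
- by move=> s1 s2 t1 t2 _ -> _ ->.
- by move=> s1 s2 t1 t2 _ -> _ ->.
- by move=> *; apply/funext => k; rewrite addrA.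
- by move=> *; apply/funext => k; rewrite addrC.
- by move=> *; apply/funext => k; rewrite /dl scale0r if_same add0r.
- move=> *; apply/funext => k.
  by rewrite conv_dl0l mulr_algl scaleN1r addNr /dl scale0r if_same.
- by move=> *; rewrite convA.
- by move=> *; apply/funext => k; rewrite conv_dl0l scale1r mul1r.
- by move=> *; rewrite convDl.
- by move=> *; rewrite convDr.
- by move=> c d; apply/funext => k; rewrite /dl; case: eqP; rewrite ?addr0 // scalerDl.
- by move=> c d; rewrite conv_dl mulr_algl scalerA.
- by move=> c s'; rewrite conv_dl0l conv_dl0r; apply/funext => k; rewrite mulr_algl mulr_algr.
- by move=> j; rewrite qcomp_rel; apply/funext => k; rewrite /dl scale0r !if_same.
Qed.

Definition qproj k (t : quad) : quad := qcomp (qrep t) k.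
Lemma qproj_cls k s : qproj k (qcls rel s) = qcomp s k.
Proof. by rewrite /qproj (qcomp_eq (qcls_rep rel s)). Qed.
Lemma qprojD k s t : qproj k (s + t) = qproj k s + qproj k t.
Proof.
by elim/qclsW: s => s; elim/qclsW: t => t; rewrite -qclsD !qproj_cls.
Qed.
Lemma qproj_conv k s t : qproj k (s * t) = conv (qproj^~ s) (qproj^~ t) k.
Proof.
elim/qclsW: s => s; elim/qclsW: t => t; rewrite -qclsM qproj_cls /=.
by congr (conv _ _ k); apply/funext => i; rewrite qproj_cls.
Qed.
Lemma qproj_const k c : qproj k c%:A = dl 0 c%:A k.
Proof. by rewrite -[in LHS]qclsC qproj_cls. Qed.
Lemma qproj_gen k x : qproj k (qgen rel x) = dl 1 (qgen rel x) k.
Proof. by rewrite [LHS]qproj_cls. Qed.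
Fact qproj_linear k : linear (qproj k).
Proof.
move=> c s t; rewrite qprojD; congr (_ + _).
rewrite -mulr_algl qproj_conv.
have -> : qproj^~ (c%:A : quad) = dl 0 c%:A by apply/funext => i; rewrite qproj_const.
by rewrite conv_dl0l mulr_algl.
Qed.

Let hom i (x : quad) := qproj^~ x = dl i x.
Let hom0 i : hom i 0.
Proof. by apply/funext => k; rewrite (lin0 (qproj_linear k)) /dl if_same. Qed.
Let homD i x y : hom i x -> hom i y -> hom i (x + y).
Proof.
rewrite /hom => hx hy; apply/funext => k; rewrite qprojD.
have /(congr1 (@^~ k)) /= -> := hx; have /(congr1 (@^~ k)) /= -> := hy.
by rewrite /dl; case: eqP; rewrite ?addr0.
Qed.
Let homM i j x y : hom i x -> hom j y -> hom (i + j) (x * y).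
Proof.
by move=> hx hy; apply/funext => k; rewrite qproj_conv hx hy conv_dl.
Qed.
Let hom_comp k s : hom k (qcomp s k).
Proof.
elim: s k => [x|c|s hs t ht|s hs t ht] k /=.
- rewrite /dl; case: eqP => [->|_]; last exact: hom0.
  by apply/funext => i; rewrite qproj_gen.
- rewrite /dl; case: eqP => [->|_]; last exact: hom0.
  by apply/funext => i; rewrite qproj_const.
- exact: homD.
- rewrite /conv; elim/big_ind: _ => [||i _]; [exact: hom0 | by move=> *; exact: homD|].
  by rewrite -{1}(subnKC (ltn_ord i : (i <= k)%N)); exact: homM.
Qed.
Let hom_proj k t : hom k (qproj k t). Proof. exact: hom_comp. Qed.

Fact qproj_orth k l t : qproj k (qproj l t) = if k == l then qproj l t else 0.
Proof. by have /(congr1 (@^~ k)) /= := hom_proj l t. Qed.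
Fact qproj_sum t : exists d, t = \sum_(k < d) qproj k t.
Proof.
have [r [hr ->]] : exists r : seq (nat * quad),
    (forall p, p \in r -> hom p.1 p.2) /\ t = \sum_(p <- r) p.2.
  elim/quad_ind: t => [x|c|s t [r [hr ->]] [r' [hr' ->]]|s t [r [hr ->]] [r' [hr' ->]]].
  - exists [:: (1%N, qgen rel x)]; split; last by rewrite big_seq1.
    by move=> p; rewrite inE => /eqP -> /=; apply/funext => i; rewrite qproj_gen.
  - exists [:: (0%N, c%:A)]; split; last by rewrite big_seq1.
    by move=> p; rewrite inE => /eqP -> /=; apply/funext => i; rewrite qproj_const.
  - exists (r ++ r'); split; last by rewrite big_cat.
    by move=> p; rewrite mem_cat => /orP[/hr|/hr'].
  - exists [seq ((p.1 + q.1)%N, p.2 * q.2) | p <- r, q <- r']; split.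
      by move=> _ /allpairsP[[p q] [/hr hp /hr' hq ->]]; exact: homM.
    rewrite big_allpairs_dep /= mulr_suml; apply: eq_bigr => p _.
    by rewrite mulr_sumr.
exists (\max_(p <- r) p.1).+1.
under [RHS]eq_bigr do rewrite (lin_sum _ _ _ (qproj_linear _)).
rewrite [RHS]exchange_big /= [LHS]big_seq [RHS]big_seq; apply: eq_bigr => p pr.
have pl : (p.1 < (\max_(p <- r) p.1).+1)%N by rewrite ltnS; exact: leq_bigmax_seq.
have hp k : qproj k p.2 = dl p.1 p.2 k.
  by have /(congr1 (@^~ k)) /= := hr p pr.
rewrite (bigD1 (Ordinal pl)) //= hp /dl eqxx big1 ?addr0 // => k.
by rewrite -(inj_eq val_inj) /= => /negPf kp; rewrite hp /dl kp.
Qed.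
Fact qproj1 : qproj 0 1 = 1.
Proof. by rewrite -(scale1r 1) qproj_const. Qed.
Fact qprojM k l s t :
  qproj (k + l) (qproj k s * qproj l t) = qproj k s * qproj l t.
Proof.
have /(congr1 (@^~ (k + l)%N)) /= -> := homM (hom_proj k s) (hom_proj l t).
by rewrite /dl eqxx.
Qed.

HB.instance Definition _ := isGrAlg.Build K quad
  qproj_linear qproj_orth qproj_sum qproj1 qprojM.

Lemma homog_gen x : homog 1 (qgen rel x).
Proof. by rewrite /homog [LHS]qproj_gen. Qed.

Lemma qlift_hom (S : grAlgType K) (g : X -> S) :
  qsat rel g -> alg_hom (qlift rel g).
Proof. by move=> hg; split; [exact: qlift_linear | exact: qlift_monoid]. Qed.

Lemma qlift_gr_hom (S : grAlgType K) (g : X -> S) :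
  qsat rel g -> (forall x, homog 1 (g x)) -> gr_hom (qlift rel g).
Proof.
move=> hg h1; split=> [|k x]; first exact: qlift_hom.
have [lg [g1 gM]] := qlift_hom hg.
suff: homog k (qlift rel g (qproj k x)) by move=> h e; rewrite -e.
elim/qclsW: x => s; rewrite qproj_cls.
elim: s k => [x|c|s hs t ht|s hs t ht] k /=.
- rewrite /dl; case: eqP => [->|_]; first by rewrite qlift_gen.
  by rewrite (lin0 lg); exact: homog0.
- rewrite /dl; case: eqP => [->|_]; last by rewrite (lin0 lg); exact: homog0.
  by rewrite (linZ c lg) g1; apply: homogZ; exact: homog1.
- by rewrite (linD lg); exact: homogD.
- rewrite /conv (lin_sum _ _ _ lg); apply: homog_sum => i _.
  by rewrite gM -{1}(subnKC (ltn_ord i : (i <= k)%N)); exact: homogM.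
Qed.

Lemma alg_hom_ext (S : grAlgType K) (f g : quad -> S) : alg_hom f -> alg_hom g ->
  (forall x, f (qgen rel x) = g (qgen rel x)) -> f =1 g.
Proof.
move=> [lf [f1 fM]] [lg [g1 gM]] fg t.
elim/quad_ind: t => [x|c|s t es et|s t es et] //.
- by rewrite (linZ c lf) (linZ c lg) f1 g1.
- by rewrite (linD lf) (linD lg) es et.
- by rewrite fM gM es et.
Qed.

End QuadGrading.
Section AlgHom.
Variables K : fieldType.

Lemma alg_hom_id (A : grAlgType K) : alg_hom (@id A).
Proof. by split. Qed.
Lemma alg_hom_comp (A B C : grAlgType K) (f : B -> C) (g : A -> B) :
  alg_hom f -> alg_hom g -> alg_hom (f \o g).
Proof.
move=> [lf [f1 fM]] [lg [g1 gM]]; split=> [c x y|] /=; first by rewrite lg lf.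
by split=> [|x y] /=; rewrite ?g1 ?f1 // gM fM.
Qed.
Lemma gr_hom_comp (A B C : grAlgType K) (f : B -> C) (g : A -> B) :
  gr_hom f -> gr_hom g -> gr_hom (f \o g).
Proof.
move=> [hf gf] [hg gg]; split; first exact: alg_hom_comp.
by move=> k x hx; apply: gf; exact: gg.
Qed.
Lemma manin_val_hom (A B : grAlgType K) : alg_hom (@manin_val K A B).
Proof. by split=> //; split. Qed.

Lemma tens_alg_hom_ext (A B C : grAlgType K) (f g : tens A B -> C) :
  alg_hom f -> alg_hom g -> (forall a, f (tpure a 1) = g (tpure a 1)) ->
  (forall b, f (tpure 1 b) = g (tpure 1 b)) -> f =1 g.
Proof.
move=> [lf [f1 fM]] [lg [g1 gM]] h1 h2; apply: tens_ext => // a b.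
by rewrite -[a]mulr1 -[b]mul1r -tpureM fM gM h1 h2.
Qed.

Lemma tlift_hom (A B C : grAlgType K) (f : A -> B -> C) : bilin f ->
  f 1 1 = 1 -> (forall a a' b b', f (a * a') (b * b') = f a b * f a' b') ->
  alg_hom (tlift f).
Proof.
move=> bf f1 fM; have lf := tlift_linear bf; split=> //; split.
  by rewrite -tpure1 tlift_pure.
move=> s t; elim/tens_ind: s => [a b|s s' es es']; last first.
  by rewrite mulrDl !(linD lf) es es' mulrDl.
elim/tens_ind: t => [a' b'|t t' et et']; last first.
  by rewrite mulrDr !(linD lf) et et' mulrDr.
by rewrite tpureM !tlift_pure.
Qed.

Lemma tmap_hom (A B A' B' : grAlgType K) (f : A -> A') (g : B -> B') :
  alg_hom f -> alg_hom g -> alg_hom (tmap f g).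
Proof.
move=> [lf [f1 fM]] [lg [g1 gM]]; apply: tlift_hom; first exact: tmap_bilin.
  by rewrite f1 g1 tpure1.
by move=> a a' b b'; rewrite fM gM tpureM.
Qed.

End AlgHom.

(* Structure maps of the tensor product.  The unitors K[u] ∘ B ≅ B and        *)
(* B ∘ K[u] ≅ B of the Manin product, u^k ⊗ b |-> b, are restrictions of      *)
(* tlunit and trunit.                                                         *)
Section TensorMaps.
Variable K : fieldType.

Definition tassoc (U V W : lmodType K) : tens (tens U V) W -> tens U (tens V W) :=
  tlift (fun s w => tlift (fun u v => tpure u (tpure v w)) s).

Definition tflip (U V U' V' : lmodType K) :
    tens (tens U V) (tens U' V') -> tens (tens U U') (tens V V') :=
  tlift (fun s t => tlift (fun u v =>
    tlift (fun u' v' => tpure (tpure u u') (tpure v v')) t) s).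

Definition tmult (A : algType K) : tens A A -> A := tlift (fun a a' => a * a').

Definition tlunit (U : lmodType K) : tens {poly K} U -> U :=
  tlift (fun p u => p.[1] *: u).
Definition trunit (U : lmodType K) : tens U {poly K} -> U :=
  tlift (fun u p => p.[1] *: u).

Section Assoc.
Variables U V W : lmodType K.

Fact tassoc_bilin1 (w : W) : bilin (fun (u : U) (v : V) => tpure u (tpure v w)).
Proof.
split=> [v c u u'|u c v v']; first by rewrite tpureDl tpureZl.
by rewrite tpureDl tpureZl tpureDr tpureZr.
Qed.
Fact tassoc_bilin2 : bilin (fun (s : tens U V) (w : W) =>
  tlift (fun u v => tpure u (tpure v w)) s).
Proof.
split=> [w|s c w w']; first exact: (tlift_linear (tassoc_bilin1 w)).
elim/tens_ind: s => [u v|s t es et].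
  rewrite !(tlift_pure _ _ (tassoc_bilin1 _)).
  by rewrite !(tpureDr, tpureZr).
by rewrite !(linD (tlift_linear (tassoc_bilin1 _))) es et scalerDr addrACA.
Qed.
Lemma tassoc_linear : linear (@tassoc U V W).
Proof. exact: (tlift_linear tassoc_bilin2). Qed.
Lemma tassoc_pure (u : U) (v : V) (w : W) :
  tassoc (tpure (tpure u v) w) = tpure u (tpure v w).
Proof.
by rewrite /tassoc (tlift_pure _ _ tassoc_bilin2) (tlift_pure _ _ (tassoc_bilin1 _)).
Qed.
End Assoc.

Section Flip.
Variables U V U' V' : lmodType K.

Fact tflip_bilin1 (u : U) (v : V) :
  bilin (fun (u' : U') (v' : V') => tpure (tpure u u') (tpure v v')).
Proof.
split=> [y c x x'|x c y y'].
  by rewrite tpureDr tpureZr tpureDl tpureZl.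
by rewrite !(tpureDr, tpureZr).
Qed.
Fact tflip_bilin2 (t : tens U' V') : bilin (fun (u : U) (v : V) =>
    tlift (fun u' v' => tpure (tpure u u') (tpure v v')) t).
Proof.
split=> [v c u u'|u c v v']; elim/tens_ind: t => [x y|s t es et];
  rewrite ?(linD (tlift_linear (tflip_bilin1 _ _))) ?es ?et ?scalerDr 1?addrACA //;
  rewrite !(tlift_pure _ _ (tflip_bilin1 _ _)).
  by rewrite !(tpureDl, tpureZl).
by rewrite tpureDl tpureZl tpureDr tpureZr.
Qed.
Fact tflip_bilin3 : bilin (fun (s : tens U V) (t : tens U' V') =>
  tlift (fun u v =>
    tlift (fun u' v' => tpure (tpure u u') (tpure v v')) t) s).
Proof.
split=> [t|s c t t']; first exact: (tlift_linear (tflip_bilin2 t)).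
elim/tens_ind: s => [u v|s s' es es'].
  rewrite !(tlift_pure _ _ (tflip_bilin2 _)).
  exact: (tlift_linear (tflip_bilin1 u v)).
by rewrite !(linD (tlift_linear (tflip_bilin2 _))) es es' scalerDr addrACA.
Qed.
Lemma tflip_linear : linear (@tflip U V U' V').
Proof. exact: (tlift_linear tflip_bilin3). Qed.
Lemma tflip_pure (u : U) (v : V) (u' : U') (v' : V') :
  tflip (tpure (tpure u v) (tpure u' v')) = tpure (tpure u u') (tpure v v').
Proof.
by rewrite /tflip (tlift_pure _ _ tflip_bilin3) (tlift_pure _ _ (tflip_bilin2 _))
  (tlift_pure _ _ (tflip_bilin1 _ _)).
Qed.
End Flip.

Fact tmult_bilin (A : algType K) : bilin (fun a a' : A => a * a').
Proof.
split=> [y c x x'|x c y y']; first by rewrite mulrDl scalerAl.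
by rewrite mulrDr scalerAr.
Qed.
Lemma tmult_linear (A : algType K) : linear (@tmult A).
Proof. exact: (tlift_linear (tmult_bilin A)). Qed.
Lemma tmult_pure (A : algType K) (a a' : A) : tmult (tpure a a') = a * a'.
Proof. by rewrite /tmult (tlift_pure _ _ (tmult_bilin A)). Qed.

Fact tlunit_bilin (U : lmodType K) : bilin (fun (p : {poly K}) (u : U) => p.[1] *: u).
Proof.
split=> [u c p q|p c u u']; first by rewrite hornerD hornerZ scalerDl scalerA.
by rewrite scalerDr !scalerA mulrC.
Qed.
Lemma tlunit_linear (U : lmodType K) : linear (@tlunit U).
Proof. exact: (tlift_linear (tlunit_bilin U)). Qed.
Lemma tlunit_pure (U : lmodType K) p (u : U) : tlunit (tpure p u) = p.[1] *: u.
Proof. by rewrite /tlunit (tlift_pure _ _ (tlunit_bilin U)). Qed.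
Fact trunit_bilin (U : lmodType K) : bilin (fun (u : U) (p : {poly K}) => p.[1] *: u).
Proof. by have [h1 h2] := tlunit_bilin U; split. Qed.
Lemma trunit_linear (U : lmodType K) : linear (@trunit U).
Proof. exact: (tlift_linear (trunit_bilin U)). Qed.
Lemma trunit_pure (U : lmodType K) p (u : U) : trunit (tpure u p) = p.[1] *: u.
Proof. by rewrite /trunit (tlift_pure _ _ (trunit_bilin U)). Qed.

Lemma tassoc_hom (A B C : grAlgType K) : alg_hom (@tassoc A B C).
Proof.
apply: (@tlift_hom K (tens A B) C (tens A (tens B C))).
- exact: tassoc_bilin2.
- by rewrite -tpure1 (tlift_pure _ _ (@tassoc_bilin1 A B C _)) !tpure1.
- have l c := tlift_linear (@tassoc_bilin1 A B C c).
  move=> s t c c'; elim/tens_ind: s => [a b|s s' es es']; last first.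
    by rewrite mulrDl !(linD (l _)) es es' mulrDl.
  elim/tens_ind: t => [a' b'|t t' et et']; last first.
    by rewrite mulrDr !(linD (l _)) et et' mulrDr.
  by rewrite tpureM !(tlift_pure _ _ (@tassoc_bilin1 A B C _)) !tpureM.
Qed.
Lemma tlunit_hom (A : grAlgType K) : alg_hom (@tlunit A).
Proof.
apply: tlift_hom; first exact: tlunit_bilin.
  by rewrite hornerC scale1r.
by move=> p q a b; rewrite hornerM -scalerAl -scalerAr scalerA.
Qed.
Lemma trunit_hom (A : grAlgType K) : alg_hom (@trunit A).
Proof.
apply: tlift_hom; first exact: trunit_bilin.
  by rewrite hornerC scale1r.
by move=> a b p q; rewrite hornerM -scalerAl -scalerAr scalerA.
Qed.

End TensorMaps.

(* Comonoids in (GrAlg, ∘).  Since A ∘ A ∘ A is a subalgebra of A ⊗ A ⊗ A,    *)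
(* coassociativity is an identity in A ⊗ (A ⊗ A).                             *)
Record comonoid (K : fieldType) := Comonoid {
  comon_alg :> grAlgType K;
  Delta : comon_alg -> manin comon_alg comon_alg;
  epsilon : comon_alg -> {poly K};
  Delta_hom : gr_hom Delta;
  epsilon_hom : gr_hom epsilon;
  Delta_assoc : forall x,
    tassoc (tmap (@manin_val _ _ _ \o Delta) id (manin_val (Delta x))) =
    tmap id (@manin_val _ _ _ \o Delta) (manin_val (Delta x));
  Delta_unitl : forall x, tlunit (tmap epsilon id (manin_val (Delta x))) = x;
  Delta_unitr : forall x, trunit (tmap id epsilon (manin_val (Delta x))) = x
}.

Section Comonoid.
Variables (K : fieldType) (O : comonoid K).

Definition Delta_ (x : O) : tens O O := manin_val (Delta x).
Definition epsilon_ (x : O) : K := (epsilon x).[1].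

Definition comon_hom (O' : comonoid K) (f : O -> O') : Prop :=
  [/\ gr_hom f,
      forall x, manin_val (Delta (f x)) = tmap f f (manin_val (Delta x)) &
      forall x, epsilon (f x) = epsilon x].

Definition coaction (B : grAlgType K) (d : B -> manin O B) : Prop :=
  [/\ gr_hom d,
      forall x, tassoc (tmap Delta_ id (manin_val (d x))) =
                tmap id (@manin_val _ _ _ \o d) (manin_val (d x)) &
      forall x, tlunit (tmap (@epsilon K O) id (manin_val (d x))) = x].

Definition first_order m (M : 'M[O]_m) : Prop := forall i j, homog 1 (M i j).

Definition multiplicative_mx m (M : 'M[O]_m) : Prop :=
  (forall i j, Delta_ (M i j) = \sum_k tpure (M i k) (M k j)) /\
  (forall i j, epsilon_ (M i j) = (i == j)%:R).

End Comonoid.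

(* B i j k l is the entry B^{ij}_{kl} of an endomorphism of K^m ⊗ K^m.        *)
Definition end2 (K : fieldType) (m : nat) := 'I_m -> 'I_m -> 'I_m -> 'I_m -> K.

Definition idempotent2 (K : fieldType) m (B : end2 K m) : Prop :=
  forall i j k l, \sum_a \sum_b B i j a b * B a b k l = B i j k l.

Definition delta2 {K : fieldType} {m} : end2 K m :=
  fun i j k l => ((i == k) && (j == l))%:R.

Definition ManinMx (K : fieldType) (A : algType K) m (B : end2 K m)
    (M : 'M[A]_m) : Prop :=
  forall i j k l, \sum_a \sum_b \sum_c \sum_d
    (B i j a b * (delta2 c d k l - B c d k l)) *: (M a c * M b d) = 0.

Section XB.
Variables (K : fieldType) (m : nat) (B : end2 K m).

Definition Xrel (p : 'I_m * 'I_m) (k l : 'I_m) : K := B p.1 p.2 k l.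
Definition XB : grAlgType K := quad Xrel.
Definition Xgen (i : 'I_m) : XB := qgen Xrel i.

(* Relations of coend, indexed by (i, j, k, l); the generator 𝓜^a_c is        *)
(* indexed by the pair (a, c).                                                *)
Definition coend_rel (p : ('I_m * 'I_m) * ('I_m * 'I_m)) (x y : 'I_m * 'I_m) : K :=
  let: ((i, j), (k, l)) := p in let: (a, c) := x in let: (b, d) := y in
  B i j a b * (delta2 c d k l - B c d k l).
Definition coend_alg : grAlgType K := quad coend_rel.
Definition coend_gen (i j : 'I_m) : coend_alg := qgen coend_rel (i, j).

Lemma ManinMxP (A : algType K) (M : 'M[A]_m) :
  ManinMx B M <-> qsat coend_rel (fun p => M p.1 p.2).
Proof.
have e i j k l : \sum_(x : 'I_m * 'I_m) \sum_(y : 'I_m * 'I_m)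
    coend_rel ((i, j), (k, l)) x y *: (M x.1 x.2 * M y.1 y.2) =
  \sum_a \sum_b \sum_c \sum_d
    (B i j a b * (delta2 c d k l - B c d k l)) *: (M a c * M b d).
  pose G a b c d := (B i j a b * (delta2 c d k l - B c d k l)) *: (M a c * M b d).
  transitivity (\sum_(x : 'I_m * 'I_m) \sum_(y : 'I_m * 'I_m) G x.1 y.1 x.2 y.2).
    by apply: eq_bigr => -[a c] _; apply: eq_bigr => -[b d] _.
  rewrite -(pair_bigA _ (fun a c => \sum_(y : 'I_m * 'I_m) G a y.1 c y.2)) /=.
  apply: eq_bigr => a _; rewrite [RHS]exchange_big; apply: eq_bigr => c _ /=.
  rewrite -(pair_bigA _ (fun b d => G a b c d)) /=.
  by [].
by split=> [h [[i j] [k l]]|h i j k l]; rewrite ?e ?h // -e h.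
Qed.

End XB.
Section Coend.
Variables (K : fieldType) (m : nat) (B : end2 K m).
Local Notation C := (coend_alg B).
Local Notation P := ('I_m * 'I_m)%type.

Let b (p q : P) : K := B p.1 p.2 q.1 q.2.

Lemma coend_rel_pair (A : algType K) (g : P -> A) :
  qsat (coend_rel B) g <-> forall p q : P,
  \sum_(x : P) \sum_(y : P) (b p x * ((y == q)%:R - b y q)) *:
    (g (x.1, y.1) * g (x.2, y.2)) = 0.
Proof.
have -> : g = (fun p => (\matrix_(i, j) g (i, j)) p.1 p.2).
  by apply/funext => -[i j] /=; rewrite mxE.
have e (M : 'M[A]_m) i j k l : \sum_a \sum_b \sum_c \sum_d
    (B i j a b * (delta2 c d k l - B c d k l)) *: (M a c * M b d) =
  \sum_(x : P) \sum_(y : P) (b (i, j) x * ((y == (k, l))%:R - b y (k, l))) *: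
    (M x.1 y.1 * M x.2 y.2).
  pose G a b c d := (B i j a b * (delta2 c d k l - B c d k l)) *: (M a c * M b d).
  transitivity (\sum_(x : P) \sum_(y : P) G x.1 x.2 y.1 y.2).
    rewrite -(pair_bigA _ (fun a b => \sum_(y : P) G a b y.1 y.2)) /=.
    apply: eq_bigr => a _; apply: eq_bigr => c _.
    by rewrite -(pair_bigA _ (fun d d' => G a c d d')).
  apply: eq_bigr => -[x1 x2] _; apply: eq_bigr => -[y1 y2] _.
  by rewrite /G /b /delta2 /= xpair_eqE.
split=> [/ManinMxP h [p1 p2] [q1 q2]|h]; first by rewrite -e h.
by apply/ManinMxP => i j k l; rewrite e h.
Qed.

Definition coend_mulgen (p : P) : manin C C :=
  \sum_(k < m) Manin (manin_pure (homog_gen (coend_rel B) (p.1, k))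
                                 (homog_gen (coend_rel B) (k, p.2))).
Definition coend_Delta : C -> manin C C := qlift (coend_rel B) coend_mulgen.
Definition coend_epsilon : C -> {poly K} :=
  qlift (coend_rel B) (fun p => (p.1 == p.2)%:R *: 'X).

Lemma coend_mulgenE p : manin_val (coend_mulgen p) =
  \sum_k tpure (coend_gen B p.1 k) (coend_gen B k p.2).
Proof. exact: (raddf_sum (val : manin C C -> _)). Qed.

Let mv_sum (I : finType) (F : I -> manin C C) :
  manin_val (\sum_i F i) = \sum_i manin_val (F i).
Proof. exact: (lin_sum _ _ _ (proj1 (manin_val_hom C C))). Qed.

Fact coend_Delta_sat : qsat (coend_rel B) coend_mulgen.
Proof.
apply/coend_rel_pair => p q; apply: manin_inj.
rewrite mv_sum [RHS]/=; under eq_bigr do rewrite mv_sum.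
pose MM (x y : P) : C := coend_gen B x.1 y.1 * coend_gen B x.2 y.2.
pose L x : C := \sum_y b p y *: MM y x.
pose R x : C := \sum_y ((y == q)%:R - b y q) *: MM x y.
have hL x : L x = \sum_y b y x *: L y.
  have /coend_rel_pair/(_ p x) := qgen_rel (coend_rel B).
  move=> h; apply/eqP; rewrite -subr_eq0 -[X in _ == X]h; apply/eqP.
  have -> : \sum_y b y x *: L y =
      \sum_x0 \sum_y (b p x0 * b y x) *: MM x0 y.
    rewrite exchange_big; apply: eq_bigr => y _; rewrite scaler_sumr.
    by apply: eq_bigr => z _; rewrite scalerA mulrC.
  have -> : L x = \sum_x0 \sum_y (b p x0 * (y == x)%:R) *: MM x0 y.
    apply: eq_bigr => y _; rewrite (bigD1 x) //= eqxx mulr1 big1 ?addr0 //.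
    by move=> z /negPf ->; rewrite mulr0 scale0r.
  rewrite -sumrB; apply: eq_bigr => y _; rewrite -sumrB; apply: eq_bigr => z _.
  by rewrite -scalerBl -mulrBr.
have hR p' : \sum_x b p' x *: R x = 0.
  have /coend_rel_pair/(_ p' q) := qgen_rel (coend_rel B).
  move=> h; rewrite -[RHS]h; apply: eq_bigr => x _; rewrite scaler_sumr.
  by apply: eq_bigr => y _; rewrite scalerA.
transitivity (\sum_x (tpure (L x) (R x) : tens C C)).
  transitivity (\sum_(x : P) \sum_(y : P) \sum_(z : P)
     (tpure (b p x *: MM x z) (((y == q)%:R - b y q) *: MM z y) : tens C C)).
    apply: eq_bigr => x _; apply: eq_bigr => y _.
    rewrite [manin_val _]/= !coend_mulgenE /=.
    rewrite mulr_suml scaler_sumr.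
    rewrite -(pair_bigA _ (fun i j => tpure (b p x *: MM x (i, j)) (((y == q)%:R - b y q) *: MM (i, j) y))) /=.
    apply: eq_bigr => i _; rewrite mulr_sumr scaler_sumr; apply: eq_bigr => j _.
    by rewrite tpureZl tpureZr scalerA tpureM.
  rewrite exchange_big /=.
  under eq_bigr do rewrite exchange_big /=.
  rewrite exchange_big /=; apply: eq_bigr => z _.
  rewrite /L tpure_suml [RHS]/= exchange_big; apply: eq_bigr => x _.
  by rewrite /R tpure_sumr.
transitivity (\sum_x \sum_y b y x *: (tpure (L y) (R x) : tens C C)).
  apply: eq_bigr => x _; rewrite {1}hL tpure_suml; apply: eq_bigr => y _.
  by rewrite tpureZl.
rewrite exchange_big big1 //= => y _.
transitivity (tpure (L y) (\sum_x b y x *: R x)); last by rewrite hR tpure0r.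
by rewrite tpure_sumr; apply: eq_bigr => x _; rewrite tpureZr.
Qed.

Fact coend_epsilon_sat : idempotent2 B ->
  qsat (coend_rel B) (fun p => (p.1 == p.2)%:R *: 'X : {poly K}).
Proof.
move=> Bid; apply/coend_rel_pair => p q /=.
have bid : \sum_x b p x * b x q = b p q.
  rewrite /b -[RHS]Bid (pair_bigA _ (fun a c => B p.1 p.2 a c * B a c q.1 q.2)).
  by [].
transitivity (\sum_x (b p x * ((x == q)%:R - b x q)) *: ('X * 'X : {poly K})).
  apply: eq_bigr => x _; rewrite (bigD1 x) //= !eqxx !scale1r big1 ?addr0 //.
  move=> y yx; have : ((x.1 == y.1) && (x.2 == y.2)) = false.
    by rewrite eq_sym (eq_sym x.2) -xpair_eqE -!surjective_pairing (negPf yx).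
  by case: eqP => _; case: eqP => _ //; rewrite !scale0r ?(mul0r, mulr0) scaler0.
rewrite -scaler_suml.
have -> : \sum_x b p x * ((x == q)%:R - b x q) = 0; last by rewrite scale0r.
under eq_bigr do rewrite mulrBr.
rewrite sumrB bid (bigD1 q) //= eqxx mulr1 big1 ?addr0 ?subrr //.
by move=> x /negPf ->; rewrite mulr0.
Qed.

Fact coend_Delta_hom : gr_hom coend_Delta.
Proof.
apply: qlift_gr_hom; first exact: coend_Delta_sat.
move=> p; apply: homog_sum => k _; apply: val_inj; rewrite [LHS]/=.
by rewrite tbiproj_pure !homog_gen.
Qed.
Lemma coend_Delta_gen i j : manin_val (coend_Delta (coend_gen B i j)) =
  \sum_k tpure (coend_gen B i k) (coend_gen B k j).
Proof. by rewrite /coend_Delta qlift_gen ?coend_mulgenE //; exact: coend_Delta_sat. Qed.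

Hypothesis Bid : idempotent2 B.

Fact coend_epsilon_hom : gr_hom coend_epsilon.
Proof.
apply: qlift_gr_hom; first exact: coend_epsilon_sat.
move=> p; apply: homogZ; rewrite /homog /grproj /= /pproj coefX scale1r.
by rewrite expr1.
Qed.
Lemma coend_epsilon_gen i j :
  coend_epsilon (coend_gen B i j) = (i == j)%:R *: 'X.
Proof. by rewrite /coend_epsilon qlift_gen //; exact: coend_epsilon_sat. Qed.

Let dh : alg_hom (@manin_val _ _ _ \o coend_Delta).
Proof. by apply: alg_hom_comp (manin_val_hom _ _) _; have [] := coend_Delta_hom. Qed.
Let eh : alg_hom coend_epsilon.
Proof. by have [] := coend_epsilon_hom. Qed.

Fact coend_assoc x :
    tassoc (tmap (@manin_val _ _ _ \o coend_Delta) id (manin_val (coend_Delta x))) =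
    tmap id (@manin_val _ _ _ \o coend_Delta) (manin_val (coend_Delta x)).
Proof.
have idh := alg_hom_id C.
have [dl _] := dh; have [il _] := idh.
have h1 := alg_hom_comp (alg_hom_comp (tassoc_hom C C C) (tmap_hom dh idh)) dh.
have h2 := alg_hom_comp (tmap_hom idh dh) dh.
apply: (alg_hom_ext h1 h2) => -[i j] /=; rewrite -/(coend_gen B i j).
rewrite coend_Delta_gen !(lin_sum _ _ _ (tmap_linear _ _)) // (lin_sum _ _ _ (@tassoc_linear _ _ _ _)).
under eq_bigr do rewrite tmap_pure //= coend_Delta_gen tpure_suml (lin_sum _ _ _ (@tassoc_linear _ _ _ _)).
under [RHS]eq_bigr do rewrite tmap_pure //= coend_Delta_gen tpure_sumr.
rewrite exchange_big; apply: eq_bigr => k _; apply: eq_bigr => l _ /=.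
by rewrite tassoc_pure.
Qed.
Fact coend_unitl x : tlunit (tmap coend_epsilon id (manin_val (coend_Delta x))) = x.
Proof.
have idh := alg_hom_id C.
have [dl _] := dh; have [il _] := idh; have [el _] := eh.
have h1 := alg_hom_comp (alg_hom_comp (tlunit_hom C) (tmap_hom eh idh)) dh.
apply: (alg_hom_ext h1 idh) => -[i j] /=; rewrite -/(coend_gen B i j).
rewrite coend_Delta_gen !(lin_sum _ _ _ (tmap_linear _ _)) // (lin_sum _ _ _ (@tlunit_linear _ _)).
under eq_bigr do rewrite tmap_pure //= coend_epsilon_gen tlunit_pure hornerZ hornerX mulr1.
rewrite (bigD1 i) //= eqxx scale1r big1 ?addr0 // => k.
by rewrite eq_sym => /negPf ->; rewrite scale0r.
Qed.
Fact coend_unitr x : trunit (tmap id coend_epsilon (manin_val (coend_Delta x))) = x.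
Proof.
have idh := alg_hom_id C.
have [dl _] := dh; have [il _] := idh; have [el _] := eh.
have h1 := alg_hom_comp (alg_hom_comp (trunit_hom C) (tmap_hom idh eh)) dh.
apply: (alg_hom_ext h1 idh) => -[i j] /=; rewrite -/(coend_gen B i j).
rewrite coend_Delta_gen !(lin_sum _ _ _ (tmap_linear _ _)) // (lin_sum _ _ _ (@trunit_linear _ _)).
under eq_bigr do rewrite tmap_pure //= coend_epsilon_gen trunit_pure hornerZ hornerX mulr1.
rewrite (bigD1 j) //= eqxx scale1r big1 ?addr0 // => k.
by move=> /negPf ->; rewrite scale0r.
Qed.

Definition coend : comonoid K :=
  Comonoid coend_Delta_hom coend_epsilon_hom coend_assoc coend_unitl coend_unitr.

End Coend.
Section DiS.
Variables (K : fieldType) (m n : nat) (B : end2 K m) (C : end2 K n).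

Definition DiS : end2 K (m + n) := fun i j k l =>
  match split i, split j, split k, split l with
  | inl i, inl j, inl k, inl l => B i j k l
  | inr a, inr b, inr c, inr d => C a b c d
  | inl i, inr a, inl k, inr c => ((i == k) && (a == c))%:R / 2%:R
  | inr a, inl i, inr c, inl k => ((i == k) && (a == c))%:R / 2%:R
  | inl i, inr a, inr c, inl k => - (((i == k) && (a == c))%:R / 2%:R)
  | inr a, inl i, inl k, inr c => - (((i == k) && (a == c))%:R / 2%:R)
  | _, _, _, _ => 0
  end.

Lemma split_l (i : 'I_m) : split (lshift n i) = inl i.
Proof. exact: (unsplitK (inl i : 'I_m + 'I_n)). Qed.
Lemma split_r (a : 'I_n) : split (rshift m a) = inr a.
Proof. exact: (unsplitK (inr a : 'I_m + 'I_n)). Qed.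
Definition splitE := (split_l, split_r).

Variant split_view : 'I_(m + n) -> Type :=
| SplitL (i : 'I_m) : split_view (lshift n i)
| SplitR (a : 'I_n) : split_view (rshift m a).
Lemma splitV i : split_view i.
Proof. by rewrite -(splitK i); case: (split i) => j; constructor. Qed.

Lemma sum2_split (V : zmodType) (F : 'I_(m + n) -> 'I_(m + n) -> V) :
  \sum_i \sum_j F i j =
  (\sum_i \sum_j F (lshift n i) (lshift n j) +
   \sum_i \sum_b F (lshift n i) (rshift m b)) +
  (\sum_a \sum_j F (rshift m a) (lshift n j) +
   \sum_a \sum_b F (rshift m a) (rshift m b)).
Proof.
rewrite big_split_ord /= -!big_split.
by congr (_ + _); apply: eq_bigr => i _; rewrite big_split_ord.
Qed.

Lemma sum2_delta (V : zmodType) p q (i : 'I_p) (a : 'I_q) (F : 'I_p -> 'I_q -> V) :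
  (forall k c, (k == i) && (c == a) = false -> F k c = 0) ->
  \sum_k \sum_c F k c = F i a.
Proof.
move=> h; rewrite (bigD1 i) //= (bigD1 a) //= !big1 ?addr0 //.
  by move=> k /negPf ki; apply: big1 => c _; apply: h; rewrite ki.
by move=> c /negPf ca; apply: h; rewrite ca andbF.
Qed.

Fact DiS_idem : 2%N \notin [pchar K] ->
  idempotent2 B -> idempotent2 C -> idempotent2 DiS.
Proof.
rewrite inE /= => n2 Bid Cid.
have h (x : K) : 2%:R^-1 * x + 2%:R^-1 * x = x.
  by rewrite -mulrDl -mulr2n -[_ *+ 2]mulr_natr mulVf // mul1r.
have z p q (F : 'I_p -> 'I_q -> K) : (forall k c, F k c = 0) ->
    \sum_k \sum_c F k c = 0.
  by move=> F0; rewrite big1 // => k _; rewrite big1.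
move=> i j k l; rewrite sum2_split.
have f x y : (x == y) = false -> (y == x) = false by rewrite eq_sym.
case/splitV: i => [i|a]; case/splitV: j => [j|b].
- rewrite [X in (_ + X) + _]z ?addr0; last by move=> *; rewrite /DiS !splitE mul0r.
  rewrite [X in _ + (X + _)]z ?add0r; last by move=> *; rewrite /DiS !splitE mul0r.
  rewrite [X in _ + X]z ?addr0; last by move=> *; rewrite /DiS !splitE mul0r.
  case/splitV: k => [k|c]; case/splitV: l => [l|d]; rewrite /DiS !splitE;
    try by apply: z => *; rewrite !splitE mulr0.
  rewrite -[RHS]Bid; apply: eq_bigr => x _; apply: eq_bigr => y _.
  by rewrite !splitE.
- rewrite [X in (X + _) + _]z ?add0r; last by move=> *; rewrite /DiS !splitE mul0r.
  rewrite [X in _ + (_ + X)]z ?addr0; last by move=> *; rewrite /DiS !splitE mul0r.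
  rewrite (@sum2_delta _ _ _ i b); last first.
    by move=> x y; rewrite /DiS !splitE (eq_sym x) (eq_sym y) => ->; rewrite !mul0r.
  rewrite (@sum2_delta _ _ _ b i); last first.
    move=> x y; rewrite /DiS !splitE (eq_sym x) (eq_sym y) andbC => ->.
    by rewrite mul0r oppr0 mul0r.
  case/splitV: k => [k|c]; case/splitV: l => [l|d]; rewrite /DiS !splitE !eqxx /=
    ?mulr0 ?addr0 //.
    by rewrite mulrNN !mul1r h.
  by rewrite mulrN mulNr !mul1r -opprD h.
- rewrite [X in (X + _) + _]z ?add0r; last by move=> *; rewrite /DiS !splitE mul0r.
  rewrite [X in _ + (_ + X)]z ?addr0; last by move=> *; rewrite /DiS !splitE mul0r.
  rewrite (@sum2_delta _ _ _ j a); last first.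
    move=> x y; rewrite /DiS !splitE (eq_sym x) (eq_sym y) => ->.
    by rewrite mul0r oppr0 mul0r.
  rewrite (@sum2_delta _ _ _ a j); last first.
    by move=> x y; rewrite /DiS !splitE (eq_sym x) (eq_sym y) andbC => ->; rewrite !mul0r.
  case/splitV: k => [k|c]; case/splitV: l => [l|d]; rewrite /DiS !splitE !eqxx /=
    ?mulr0 ?addr0 //.
    by rewrite mulNr mulrN !mul1r -opprD h.
  by rewrite mulrNN !mul1r h.
- rewrite [X in (_ + X) + _]z ?addr0; last by move=> *; rewrite /DiS !splitE mul0r.
  rewrite [X in _ + (X + _)]z ?add0r; last by move=> *; rewrite /DiS !splitE mul0r.
  rewrite [X in X + _]z ?add0r; last by move=> *; rewrite /DiS !splitE mul0r.
  case/splitV: k => [k|c]; case/splitV: l => [l|d]; rewrite /DiS !splitE;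
    try by apply: z => *; rewrite !splitE mulr0.
  rewrite -[RHS]Cid; apply: eq_bigr => x _; apply: eq_bigr => y _.
  by rewrite !splitE.
Qed.

End DiS.
(* The identification X_B ⊗ X_C = X_D for D = DiS(B, C).                      *)
Section DiSIso.
Variables (K : fieldType) (m n : nat) (B : end2 K m) (C : end2 K n).
Local Notation D := (DiS B C).
Local Notation T := (tens (XB B) (XB C)).

Definition XD_inl : XB B -> XB D :=
  qlift (Xrel B) (fun i => Xgen D (lshift n i)).
Definition XD_inr : XB C -> XB D :=
  qlift (Xrel C) (fun a => Xgen D (rshift m a)).

(* b ⊗ c |-> b c *)
Definition XD_of_tens : T -> XB D := tlift (fun b c => XD_inl b * XD_inr c).

(* w^i |-> w^i ⊗ 1 and w^(m + a) |-> 1 ⊗ w^a *)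
Definition tens_of_XD : XB D -> T :=
  qlift (Xrel D) (fun i => match split i with
    | inl i => tpure (Xgen B i) 1
    | inr a => tpure 1 (Xgen C a)
    end).

Let z p q (F : 'I_p -> 'I_q -> XB D) : (forall k c, F k c = 0) ->
  \sum_k \sum_c F k c = 0.
Proof. by move=> F0; rewrite big1 // => k _; rewrite big1. Qed.
Let zT p q (F : 'I_p -> 'I_q -> T) : (forall k c, F k c = 0) ->
  \sum_k \sum_c F k c = 0.
Proof. by move=> F0; rewrite big1 // => k _; rewrite big1. Qed.

Fact XD_inl_sat : qsat (Xrel B) (fun i => Xgen D (lshift n i)).
Proof.
move=> [p q]; have := qgen_rel (Xrel D) (lshift n p, lshift n q).
rewrite sum2_split.
rewrite [X in (_ + X) + _]z ?addr0; last by move=> *; rewrite /Xrel /DiS !splitE scale0r.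
rewrite [X in _ + (X + _)]z ?add0r; last by move=> *; rewrite /Xrel /DiS !splitE scale0r.
rewrite [X in _ + X]z ?addr0; last first.
  by move=> *; rewrite /Xrel /DiS !splitE scale0r.
move=> h; rewrite -[RHS]h; apply: eq_bigr => i _; apply: eq_bigr => j _.
by rewrite /Xrel /DiS !splitE.
Qed.
Fact XD_inr_sat : qsat (Xrel C) (fun a => Xgen D (rshift m a)).
Proof.
move=> [p q]; have := qgen_rel (Xrel D) (rshift m p, rshift m q).
rewrite sum2_split.
rewrite [X in (_ + X) + _]z ?addr0; last by move=> *; rewrite /Xrel /DiS !splitE scale0r.
rewrite [X in _ + (X + _)]z ?add0r; last by move=> *; rewrite /Xrel /DiS !splitE scale0r.
rewrite [X in X + _]z ?add0r; last by move=> *; rewrite /Xrel /DiS !splitE scale0r.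
move=> h; rewrite -[RHS]h; apply: eq_bigr => i _; apply: eq_bigr => j _.
by rewrite /Xrel /DiS !splitE.
Qed.
Fact tens_of_XD_sat : qsat (Xrel D) (fun i => match split i with
    | inl i => tpure (Xgen B i) 1 : T
    | inr a => tpure 1 (Xgen C a)
    end).
Proof.
have h0 (x : bool) (t : T) : (x%:R / 2%:R) *: t + (- (x%:R / 2%:R)) *: t = 0.
  by rewrite scaleNr subrr.
move=> [p q]; rewrite sum2_split.
case: (splitV p) => {p} [i|a]; case: (splitV q) => {q} [j|b].
- rewrite [X in (_ + X) + _]zT ?addr0; last by move=> *; rewrite /Xrel /DiS !splitE scale0r.
  rewrite [X in _ + (X + _)]zT ?add0r; last by move=> *; rewrite /Xrel /DiS !splitE scale0r.
  rewrite [X in _ + X]zT ?addr0; last by move=> *; rewrite /Xrel /DiS !splitE scale0r.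
  transitivity (\sum_k \sum_l (tpure (B i j k l *: (Xgen B k * Xgen B l)) 1 : T)).
    apply: eq_bigr => k _; apply: eq_bigr => l _.
    by rewrite /Xrel /DiS !splitE tpureM mulr1 tpureZl.
  under eq_bigr do rewrite -tpure_suml.
  by rewrite -tpure_suml (qgen_rel (Xrel B) (i, j)) tpure0l.
- rewrite [X in (X + _) + _]zT ?add0r; last by move=> *; rewrite /Xrel /DiS !splitE scale0r.
  rewrite [X in _ + (_ + X)]zT ?addr0; last by move=> *; rewrite /Xrel /DiS !splitE scale0r.
  rewrite (@sum2_delta _ _ _ i b); last first.
    by move=> x y; rewrite /Xrel /DiS !splitE (eq_sym x) (eq_sym y) => ->; rewrite !mul0r scale0r.
  rewrite (@sum2_delta _ _ _ b i); last first.
    move=> x y; rewrite /Xrel /DiS !splitE (eq_sym x) (eq_sym y) andbC => ->.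
    by rewrite mul0r oppr0 scale0r.
  by rewrite /Xrel /DiS !splitE !tpureM !mulr1 !mul1r h0.
- rewrite [X in (X + _) + _]zT ?add0r; last by move=> *; rewrite /Xrel /DiS !splitE scale0r.
  rewrite [X in _ + (_ + X)]zT ?addr0; last by move=> *; rewrite /Xrel /DiS !splitE scale0r.
  rewrite (@sum2_delta _ _ _ j a); last first.
    move=> x y; rewrite /Xrel /DiS !splitE (eq_sym x) (eq_sym y) => ->.
    by rewrite mul0r oppr0 scale0r.
  rewrite (@sum2_delta _ _ _ a j); last first.
    by move=> x y; rewrite /Xrel /DiS !splitE (eq_sym x) (eq_sym y) andbC => ->; rewrite !mul0r scale0r.
  by rewrite /Xrel /DiS !splitE !tpureM !mulr1 !mul1r addrC h0.
- rewrite [X in (_ + X) + _]zT ?addr0; last by move=> *; rewrite /Xrel /DiS !splitE scale0r.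
  rewrite [X in _ + (X + _)]zT ?add0r; last by move=> *; rewrite /Xrel /DiS !splitE scale0r.
  rewrite [X in X + _]zT ?add0r; last by move=> *; rewrite /Xrel /DiS !splitE scale0r.
  transitivity (\sum_k \sum_l (tpure 1 (C a b k l *: (Xgen C k * Xgen C l)) : T)).
    apply: eq_bigr => k _; apply: eq_bigr => l _.
    by rewrite /Xrel /DiS !splitE tpureM mulr1 tpureZr.
  under eq_bigr do rewrite -tpure_sumr.
  by rewrite -tpure_sumr (qgen_rel (Xrel C) (a, b)) tpure0r.
Qed.

Lemma XD_inl_hom : gr_hom XD_inl.
Proof. by apply: qlift_gr_hom => [|i]; [exact: XD_inl_sat | exact: homog_gen]. Qed.
Lemma XD_inr_hom : gr_hom XD_inr.
Proof. by apply: qlift_gr_hom => [|i]; [exact: XD_inr_sat | exact: homog_gen]. Qed.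
Lemma tens_of_XD_hom : gr_hom tens_of_XD.
Proof.
apply: qlift_gr_hom => [|i]; first exact: tens_of_XD_sat.
case: (splitV i) => [j|a]; rewrite splitE.
  by rewrite -[1%N]addn0; apply: homog_tpure; [exact: homog_gen | exact: homog1].
by rewrite -[1%N]add0n; apply: homog_tpure; [exact: homog1 | exact: homog_gen].
Qed.

Fact XD_of_tens_bilin : bilin (fun b c => XD_inl b * XD_inr c).
Proof.
have [[ll _] _] := XD_inl_hom; have [[lr _] _] := XD_inr_hom.
split=> [v c u u'|u c v v']; first by rewrite ll mulrDl scalerAl.
by rewrite lr mulrDr scalerAr.
Qed.
Lemma XD_of_tens_linear : linear XD_of_tens.
Proof. exact: (tlift_linear XD_of_tens_bilin). Qed.
Lemma XD_of_tens_pure b c : XD_of_tens (tpure b c) = XD_inl b * XD_inr c.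
Proof. by rewrite /XD_of_tens (tlift_pure _ _ XD_of_tens_bilin). Qed.
Lemma XD_of_tens_homog k t : homog k t -> homog k (XD_of_tens t).
Proof.
have [_ gl] := XD_inl_hom; have [_ gr] := XD_inr_hom.
rewrite {1}/homog => <-; rewrite /grproj /=; have [s ->] := tprojP k t.
rewrite (lin_sum _ _ _ XD_of_tens_linear); apply: homog_sum => p pk.
rewrite XD_of_tens_pure -(subnKC pk).
by apply: homogM; [apply: gl | rewrite addKn; apply: gr]; exact: homog_proj.
Qed.

Lemma XD_comm : 2%N \notin [pchar K] -> forall b c,
  XD_inl b * XD_inr c = XD_inr c * XD_inl b.
Proof.
rewrite inE /= => n2 b c.
have [[ll [l1 lM]] _] := XD_inl_hom; have [[lr [r1 rM]] _] := XD_inr_hom.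
elim/quad_ind: b => [i|k|s t hs ht|s t hs ht].
- elim/quad_ind: c => [a|k|s t hs ht|s t hs ht].
  + rewrite /XD_inl /XD_inr !qlift_gen; [|exact: XD_inr_sat|exact: XD_inl_sat].
    have := qgen_rel (Xrel D) (lshift n i, rshift m a).
    rewrite sum2_split.
    rewrite [X in (X + _) + _]z ?add0r; last by move=> *; rewrite /Xrel /DiS !splitE scale0r.
    rewrite [X in _ + (_ + X)]z ?addr0; last by move=> *; rewrite /Xrel /DiS !splitE scale0r.
    rewrite (@sum2_delta _ _ _ i a); last first.
      by move=> x y; rewrite /Xrel /DiS !splitE (eq_sym x) (eq_sym y) => ->; rewrite !mul0r scale0r.
    rewrite (@sum2_delta _ _ _ a i); last first.
      move=> x y; rewrite /Xrel /DiS !splitE (eq_sym x) (eq_sym y) andbC => ->.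
      by rewrite mul0r oppr0 scale0r.
    rewrite /Xrel /DiS !splitE !eqxx /= scaleNr -scalerBr => h.
    apply/eqP; rewrite -subr_eq0; apply/eqP.
    have := congr1 (fun x => 2%:R *: x) h.
    by rewrite scaler0 scalerA mul1r mulfV // scale1r.
  + by rewrite (linZ k lr) r1 -scalerAr -scalerAl mulr1 mul1r.
  + by rewrite (linD lr) mulrDr hs ht mulrDl.
  + by rewrite rM mulrA hs -mulrA ht mulrA.
- by rewrite (linZ k ll) l1 -scalerAr -scalerAl mulr1 mul1r.
- by rewrite (linD ll) mulrDl hs ht mulrDr.
- by rewrite lM -mulrA ht mulrA hs mulrA.
Qed.

Lemma XD_of_tens_hom : 2%N \notin [pchar K] -> gr_hom XD_of_tens.
Proof.
move=> n2; split; last exact: XD_of_tens_homog.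
have [[ll [l1 lM]] _] := XD_inl_hom; have [[lr [r1 rM]] _] := XD_inr_hom.
apply: tlift_hom; first exact: XD_of_tens_bilin.
  by rewrite l1 r1 mulr1.
move=> b b' c c'; rewrite lM rM -!mulrA; congr (_ * _).
by rewrite !mulrA XD_comm.
Qed.

Lemma tens_of_XDK : 2%N \notin [pchar K] -> cancel tens_of_XD XD_of_tens.
Proof.
move=> n2; have [h1 _] := XD_of_tens_hom n2; have [h2 _] := tens_of_XD_hom.
have [[_ [l1 _]] _] := XD_inl_hom; have [[_ [r1 _]] _] := XD_inr_hom.
apply: (alg_hom_ext (alg_hom_comp h1 h2) (alg_hom_id _)) => i /=.
rewrite {1}/tens_of_XD qlift_gen; last exact: tens_of_XD_sat.
case: (splitV i) => [j|a]; rewrite splitE XD_of_tens_pure ?l1 ?r1 ?mul1r ?mulr1.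
  by rewrite /XD_inl qlift_gen //; exact: XD_inl_sat.
by rewrite /XD_inr qlift_gen //; exact: XD_inr_sat.
Qed.
Lemma XD_of_tensK : 2%N \notin [pchar K] -> cancel XD_of_tens tens_of_XD.
Proof.
move=> n2; have [h1 _] := XD_of_tens_hom n2; have [h2 _] := tens_of_XD_hom.
have [hl _] := XD_inl_hom; have [hr _] := XD_inr_hom.
have [_ [l1 _]] := hl; have [_ [r1 _]] := hr.
have [[l2 [e2 M2]] _] := tens_of_XD_hom.
apply: (tens_alg_hom_ext (alg_hom_comp h2 h1) (alg_hom_id _)) => [b|c] /=.
  rewrite XD_of_tens_pure r1 mulr1.
  have hL : alg_hom (fun b : XB B => tpure b 1 : T).
    split=> [c x y|]; first by rewrite tpureDl tpureZl.
    by split=> // x y; rewrite tpureM mulr1.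
  apply: (alg_hom_ext (alg_hom_comp h2 hl) hL) b => i /=.
  rewrite {1}/XD_inl qlift_gen; last exact: XD_inl_sat.
  by rewrite /tens_of_XD qlift_gen ?splitE //; exact: tens_of_XD_sat.
rewrite XD_of_tens_pure l1 mul1r.
have hR : alg_hom (fun c : XB C => tpure 1 c : T).
  split=> [k x y|]; first by rewrite tpureDr tpureZr.
  by split=> // x y; rewrite tpureM mulr1.
apply: (alg_hom_ext (alg_hom_comp h2 hr) hR) c => i /=.
rewrite {1}/XD_inr qlift_gen; last exact: XD_inr_sat.
by rewrite /tens_of_XD qlift_gen ?splitE //; exact: tens_of_XD_sat.
Qed.

End DiSIso.

Section ManinMap.
Variables (K : fieldType) (A B B' : grAlgType K) (f : B -> B').
Hypotheses (lf : linear f) (gf : forall k x, homog k x -> homog k (f x)).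

Fact manin_map_subproof (t : manin A B) :
  manin_pred (tmap id f (manin_val t) : tens A B').
Proof.
have li : linear (@id A) by [].
have /asboolP[s ->] := manin_valP t.
rewrite (lin_sum _ _ _ (tmap_linear li lf)); apply: manin_sum => p _.
rewrite tmap_pure //; apply: (manin_pure (k := p.1)); first exact: homog_proj.
by apply: gf; exact: homog_proj.
Qed.
(* id ∘ f *)
Definition manin_mapr (t : manin A B) : manin A B' :=
  Manin (manin_map_subproof t).
End ManinMap.

Section DirectSum.
Variables (K : fieldType) (O : comonoid K).

Section DPlus.
Variables (B C : grAlgType K) (d : B -> manin O B) (g : C -> manin O C).

Definition dplus_val (x : tens B C) : tens O (tens B C) :=
  tmap (@tmult K O) id
    (tflip (tmap (@manin_val _ _ _ \o d) (@manin_val _ _ _ \o g) x)).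

Fact dplus_subproof x : manin_pred (dplus_val x : tens O (tens B C)).
Proof.
have li : linear (@id (tens B C)) by [].
pose F : tens (tens O B) (tens O C) -> tens O (tens B C) :=
  fun t => tmap (@tmult K O) id (tflip t).
have lF : linear F.
  move=> c s t; rewrite /F (@tflip_linear K O B O C).
  exact: (tmap_linear (tmult_linear (A := O)) li).
rewrite /dplus_val -/(F _) /tmap /tlift.
elim: (trep x) => [b c||s hs t ht|c s hs] /=.
- have /asboolP[s ->] := manin_valP (d b); have /asboolP[s' ->] := manin_valP (g c).
  rewrite tpure_suml (lin_sum _ _ _ lF); apply: manin_sum => p _.
  rewrite tpure_sumr (lin_sum _ _ _ lF); apply: manin_sum => q _.
  rewrite /F tflip_pure (tmap_pure _ _ (tmult_linear (A := O)) li) tmult_pure.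
  apply: (manin_pure (k := (p.1 + q.1)%N)).
    by apply: homogM; exact: homog_proj.
  by apply: homog_tpure; exact: homog_proj.
- by rewrite (lin0 lF); exact: manin0.
- by rewrite (linD lF); exact: maninD.
- by rewrite (linZ c lF); exact: maninZ.
Qed.

(* δ ∔ γ *)
Definition dplus (x : tens B C) : manin O (tens B C) := Manin (dplus_subproof x).

Definition dsum_exists : Prop := alg_hom dplus.

End DPlus.

Section Quadratic.
Variables (m : nat) (B : end2 K m) (Bid : idempotent2 B).

(* d(w^i) = \sum_j M^i_j ⊗ w^j *)
Definition coaction_by (d : XB B -> manin O (XB B)) (M : 'M[O]_m) : Prop :=
  forall i, manin_val (d (Xgen B i)) = \sum_j tpure (M i j) (Xgen B j).

Definition corep (w : coend Bid -> O) : Prop := comon_hom w.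

Definition corep_by (w : coend Bid -> O) (M : 'M[O]_m) : Prop :=
  forall i j, w (coend_gen B i j) = M i j.

(* d = ϑ(w) *)
Definition theta (w : coend Bid -> O) (d : XB B -> manin O (XB B)) : Prop :=
  [/\ corep w, coaction d & exists M, corep_by w M /\ coaction_by d M].

End Quadratic.

Section QuadraticSum.
Variables (m n : nat) (B : end2 K m) (C : end2 K n).
Variables (Bid : idempotent2 B) (Cid : idempotent2 C).

(* δ ∔ γ as a map X_D -> A ∘ X_D *)
Definition dplusX (d : XB B -> manin O (XB B)) (g : XB C -> manin O (XB C)) :
    XB (DiS B C) -> manin O (XB (DiS B C)) :=
  manin_mapr (@XD_of_tens_linear K m n B C) (@XD_of_tens_homog K m n B C)
    \o dplus d g \o @tens_of_XD K m n B C.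

Definition corep_dsum_exists (w : coend Bid -> O) (v : coend Cid -> O) : Prop :=
  exists d g, [/\ theta w d, theta v g & dsum_exists d g].

(* s = w ∔ v, that is ϑ(s) = ϑ(w) ∔ ϑ(v) *)
Definition is_corep_dplus (Did : idempotent2 (DiS B C))
    (w : coend Bid -> O) (v : coend Cid -> O) (s : coend Did -> O) : Prop :=
  exists d g, [/\ theta w d, theta v g, dsum_exists d g & theta s (dplusX d g)].

End QuadraticSum.

End DirectSum.

(* Main.v *)
Require Import Defs.
From HB Require Import structures.
From mathcomp Require Import all_boot all_algebra.
From mathcomp Require Import boolp classical_sets cardinality.

Set Implicit Arguments.
Unset Strict Implicit.
Unset Printing Implicit Defensive.

Import GRing.Theory.
Local Open Scope ring_scope.

(** Write [L b] and [R c] for the images of [δ b] and [γ c] in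
    [A ⊗ (B ⊗ C)].  Then [δ ∔ γ] is the linear map [b ⊗ c |-> L b * R c]
    ([dplus_pure]), with [L] and [R] algebra homomorphisms.  Since [B ⊗ C] is
    generated by two commuting copies of [B] and [C], such a map is
    multiplicative if and only if every [L b] commutes with every [R c]
    ([dsum_existsP]), and this needs to be tested only on the generators
    ([quad_hom_comm]).  There the two products are the sums over [j, b] of
    [M i j * N a b] and of [N a b * M i j], each tensored with [w^j ⊗ w^b].
    The degree-one generators of a quadratic algebra are linearly independent,
    so the products agree if and only if the entries commute
    ([dsum_exists_commute]).

    When the direct sum exists, transporting it to [X_D] gives an algebra
    homomorphism that acts on the generators by the block diagonal matrix of
    [M] and [N] ([dplusX_by]).  Everything else follows from that formula.
    The block matrix is first order and multiplicative because [M] and [N]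
    are, which makes the homomorphism a coaction
    ([coaction_of_multiplicative]).  It is a [D]-Manin matrix because any
    homomorphism [X_D -> A ⊗ X_D] that is linear on the generators has a
    [D]-Manin matrix of coefficients ([ManinMx_of_hom]); hence it also defines
    a corepresentation ([corep_of_multiplicative]).  A coaction or a
    corepresentation is determined by its matrix, and the matrix of a coaction
    by the coaction, so passing between the two through [ϑ] is unambiguous
    ([theta_fun], [theta_corep_by]).

    The low-degree structure of quadratic algebras enters only through linear
    functionals on degrees one and two.  They are matrix entries of a
    representation by strictly triangular matrices ([test_mx]). *)

(** * Algebra homomorphisms *)

Section HomFacts.
Variable K : fieldType.

Lemma alg_hom_sum (A B : grAlgType K) (f : A -> B) (I : Type) (r : seq I)
    (P : pred I) (F : I -> A) : alg_hom f ->
  f (\sum_(i <- r | P i) F i) = \sum_(i <- r | P i) f (F i).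
Proof. by case=> lf _; exact: lin_sum. Qed.

Lemma alg_hom_into_manin (E A B : grAlgType K) (f : E -> manin A B) :
  alg_hom (@manin_val K A B \o f) -> alg_hom f.
Proof.
move=> [lf [f1 fM]]; split=> [c x y|]; first by apply: manin_inj; exact: lf.
by split=> [|x y]; apply: manin_inj; [exact: f1 | exact: fM].
Qed.

Lemma alg_hom_gen_sat (X : finType) (J : Type) (rel : J -> X -> X -> K)
    (S : grAlgType K) (f : quad rel -> S) :
  alg_hom f -> qsat rel (fun x => f (qgen rel x)).
Proof.
move=> hf; have [lf [_ fM]] := hf => j.
have := congr1 f (qgen_rel rel j); rewrite (lin0 lf) => h; rewrite -[RHS]h.
rewrite (alg_hom_sum _ _ _ hf); apply: eq_bigr => x _.
rewrite (alg_hom_sum _ _ _ hf); apply: eq_bigr => y _.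
by rewrite (linZ _ lf) fM.
Qed.

(** Such an [f] is the lift of its values on the generators, and lifts of
    degree-one elements preserve the grading. *)
Lemma gr_hom_of_gen (X : finType) (J : Type) (rel : J -> X -> X -> K)
    (S : grAlgType K) (f : quad rel -> S) :
  alg_hom f -> (forall x, homog 1 (f (qgen rel x))) -> gr_hom f.
Proof.
move=> hf h1; have fsat := alg_hom_gen_sat hf.
have -> : f = qlift rel (fun x => f (qgen rel x)).
  apply/funext; apply: alg_hom_ext => // [|x]; first exact: qlift_hom.
  by rewrite qlift_gen.
exact: qlift_gr_hom.
Qed.

Lemma quad_hom_comm (X X' : finType) (J J' : Type) (rel : J -> X -> X -> K)
    (rel' : J' -> X' -> X' -> K) (S : grAlgType K)
    (f : quad rel -> S) (g : quad rel' -> S) :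
  alg_hom f -> alg_hom g ->
  (forall x y, f (qgen rel x) * g (qgen rel' y) =
               g (qgen rel' y) * f (qgen rel x)) ->
  forall s t, f s * g t = g t * f s.
Proof.
move=> [lf [f1 fM]] [lg [g1 gM]] fg s t.
elim/quad_ind: s => [x|k|s s' hs hs'|s s' hs hs'].
- elim/quad_ind: t => [y|k|t t' ht ht'|t t' ht ht'] //.
  + by rewrite (linZ k lg) g1 -scalerAr -scalerAl mulr1 mul1r.
  + by rewrite (linD lg) mulrDr mulrDl ht ht'.
  + by rewrite gM mulrA ht -mulrA ht' mulrA.
- by rewrite (linZ k lf) f1 -scalerAr -scalerAl mulr1 mul1r.
- by rewrite (linD lf) mulrDl mulrDr hs hs'.
- by rewrite fM -mulrA hs' mulrA hs mulrA.
Qed.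

End HomFacts.

(** * Low-degree functionals on a quadratic algebra *)

Section TensorSlice.
Variables (K : fieldType) (U V : lmodType K) (phi : V -> K^o).
Hypothesis phil : linear phi.

Definition tslice : tens U V -> U := tlift (fun u v => phi v *: u).

Fact tslice_bilin : bilin (fun (u : U) v => (phi v : K) *: u).
Proof.
split=> [v c u u'|u c v v']; first by rewrite scalerDr !scalerA mulrC.
by rewrite phil scalerDl scalerA.
Qed.
Lemma tslice_linear : linear tslice.
Proof. exact: (tlift_linear tslice_bilin). Qed.
Lemma tslice_pure u v : tslice (tpure u v) = phi v *: u.
Proof. by rewrite /tslice (tlift_pure _ _ tslice_bilin). Qed.

End TensorSlice.

Section TestMatrices.
Variables (K : fieldType) (m : nat) (B : end2 K m).

(** The strictly triangular matrices with rows and columns 0, ..., m + 1 in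
    which [w^c] acts by an arrow from 0 to [c] and arrows of weight [p x c]
    from [x] to the last index.  The only paths of length 2 go from 0 through
    some [c] to the last index, so a product of two of them reads off [p]. *)
Definition test_mx (p : 'I_m -> 'I_m -> K) (c : 'I_m) : 'M[K]_((m + 1).+1) :=
  block_mx (0 : 'M_1) (row_mx (delta_mx 0 c) (0 : 'M_1))
           0 (block_mx (0 : 'M_m) (\col_x p x c) 0 (0 : 'M_1)).

Definition corner_mx : 'M[K]_((m + 1).+1) :=
  block_mx (0 : 'M_1) (row_mx (0 : 'M_(1, m)) 1%:M) 0 0.

Lemma test_mxM p c d : test_mx p c * test_mx p d = p c d *: corner_mx.
Proof.
(* Block products and block scalings need the dimension in the form
   [1 + (m + 1)], the ring structure needs it as a successor. *)
transitivity ((test_mx p c : 'M_(1 + (m + 1), 1 + (m + 1))) *m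
  (test_mx p d : 'M_(1 + (m + 1), 1 + (m + 1)))) => //.
transitivity (p c d *: (corner_mx : 'M_(1 + (m + 1), 1 + (m + 1)))) => //.
rewrite /test_mx /corner_mx mulmx_block !mulmx0 !mul0mx !addr0 !add0r.
rewrite mul_row_block mulmx_block !mulmx0 !mul0mx !addr0 block_mx_const.
have -> : delta_mx 0 c *m \col_x p x d = (p c d)%:M :> 'M_1.
  by apply/matrixP => i j; rewrite !ord1 -rowE !mxE mulr1n.
by rewrite scale_block_mx scale_row_mx !scaler0 scale_scalar_mx mulr1.
Qed.

Definition annihilated (p : 'I_m -> 'I_m -> K) : Prop :=
  forall i j, \sum_c \sum_d B i j c d * p c d = 0.

Lemma test_mx_sat p : annihilated p -> qsat (Xrel B) (test_mx p).
Proof.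
move=> hp [i j]; transitivity ((\sum_c \sum_d B i j c d * p c d) *: corner_mx).
  rewrite scaler_suml; apply: eq_bigr => c _.
  by rewrite scaler_suml; apply: eq_bigr => d _; rewrite test_mxM scalerA.
by rewrite hp scale0r.
Qed.

(** The functional [p] on [V ⊗ V] descends to the degree-two part of X_B as
    soon as it vanishes on the relations. *)
Lemma deg2_functional p : annihilated p -> exists phi : XB B -> K^o,
  linear phi /\ forall c d, phi (Xgen B c * Xgen B d) = p c d.
Proof.
move=> hp; have sat := test_mx_sat hp.
exists (fun t => (qlift (Xrel B) (test_mx p) t : 'M_(1 + (m + 1)))
                   (lshift _ ord0) (rshift 1 (rshift m ord0))).
split=> [k x y|c d]; first by rewrite (qlift_linear sat) !mxE.
have [_ ->] := qlift_monoid sat; rewrite !(qlift_gen _ sat) test_mxM.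
have e : (corner_mx : 'M_(1 + (m + 1))) (lshift _ ord0)
    (rshift 1 (rshift m ord0)) = 1.
  by rewrite block_mxEur row_mxEr mxE eqxx.
rewrite mxE; exact: etrans (congr1 _ e) (mulr1 _).
Qed.

(** With zero weights every relation is satisfied, since the test matrices
    multiply to zero; what remains of [w^c] is the arrow from 0 to [c]. *)
Lemma deg1_functional i : exists phi : XB B -> K^o,
  linear phi /\ forall c, phi (Xgen B c) = (i == c)%:R.
Proof.
have h0 : annihilated (fun _ _ => 0).
  by move=> k l; rewrite big1 // => c _; rewrite big1 // => d _; rewrite mulr0.
have sat := test_mx_sat h0.
exists (fun t => (qlift (Xrel B) (test_mx (fun _ _ => 0)) t : 'M_(1 + (m + 1)))
                   (lshift _ ord0) (rshift 1 (lshift 1 i))).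
split=> [k x y|c]; first by rewrite (qlift_linear sat) !mxE.
have e : (test_mx (fun _ _ => 0) c : 'M_(1 + (m + 1))) (lshift _ ord0)
    (rshift 1 (lshift 1 i)) = (i == c)%:R.
  by rewrite block_mxEur row_mxEl mxE eqxx.
by rewrite (qlift_gen _ sat); exact: e.
Qed.

Lemma tpure_gen_inj (A : lmodType K) (u v : 'I_m -> A) :
  \sum_j tpure (u j) (Xgen B j) = \sum_j tpure (v j) (Xgen B j) -> u =1 v.
Proof.
move=> uv i; have [phi [pl ph]] := deg1_functional i.
have e (w : 'I_m -> A) :
    tslice phi (\sum_j tpure (w j) (Xgen B j)) = w i.
  rewrite (lin_sum _ _ _ (tslice_linear pl)) (bigD1 i) //=.
  rewrite tslice_pure // ph eqxx scale1r big1 ?addr0 // => j.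
  by rewrite tslice_pure // ph eq_sym => /negPf ->; rewrite scale0r.
by rewrite -[LHS]e uv e.
Qed.

(** Applying the homomorphism to the relations of X_B makes the sum over
    [c, d] of [(B M M)_(c d) ⊗ w^c w^d] vanish.  Each column of [1 - B] is a
    well-defined functional on products of two generators, because
    [B (1 - B) = 0]; slicing by it gives a column of [B M M (1 - B) = 0]. *)
Lemma ManinMx_of_hom (A : grAlgType K) (M : 'M[A]_m) (d : XB B -> tens A (XB B)) :
  idempotent2 B -> alg_hom d ->
  (forall i, d (Xgen B i) = \sum_j tpure (M i j) (Xgen B j)) -> ManinMx B M.
Proof.
move=> Bid hd dM i j k l.
have hp : annihilated (fun c e => delta2 c e k l - B c e k l).
  move=> x y; under eq_bigr do under eq_bigr do rewrite mulrBr.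
  under eq_bigr do rewrite sumrB.
  rewrite sumrB Bid (@sum2_delta _ _ _ k l) ?/delta2 ?eqxx ?mulr1 ?subrr //.
  by move=> c e; rewrite /delta2 => ->; rewrite mulr0.
have [phi [pl ph]] := deg2_functional hp.
have := alg_hom_gen_sat hd (i, j).
move/(congr1 (tslice phi)); have ls := tslice_linear (U := A) pl.
rewrite (lin0 ls) (lin_sum _ _ _ ls) => h; rewrite -[RHS]h.
apply: eq_bigr => a _; rewrite (lin_sum _ _ _ ls); apply: eq_bigr => b _.
rewrite (linZ _ ls) -!/(Xgen B _) !dM mulr_suml (lin_sum _ _ _ ls) scaler_sumr.
apply: eq_bigr => c _; rewrite mulr_sumr (lin_sum _ _ _ ls) scaler_sumr.
by apply: eq_bigr => e _; rewrite tpureM tslice_pure // ph scalerA.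
Qed.

End TestMatrices.

(** * Coactions and corepresentations from multiplicative matrices *)

Section FromMatrix.
Variables (K : fieldType) (O : comonoid K) (m : nat) (B : end2 K m).
Implicit Types (d : XB B -> manin O (XB B)) (M : 'M[O]_m).

Lemma alg_hom_val (E A A' : grAlgType K) (f : E -> manin A A') :
  alg_hom f -> alg_hom (@manin_val K A A' \o f).
Proof. exact: alg_hom_comp (manin_val_hom _ _). Qed.

Lemma Delta_alg_hom : alg_hom (@Delta_ K O).
Proof. by apply: alg_hom_val; have [] := Delta_hom O. Qed.

(** Grading, coassociativity and counitality are identities between algebra
    homomorphisms, so they need to hold only on the generators, where they are
    the three conditions on [M]. *)
Lemma coaction_of_multiplicative d M : alg_hom d -> coaction_by d M ->
  first_order M -> multiplicative_mx M -> coaction d.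
Proof.
move=> hd dM M1 [MD Me]; have hv := alg_hom_val hd; have hD := Delta_alg_hom.
have he : alg_hom (@epsilon K O) by have [] := epsilon_hom O.
have idX := alg_hom_id (XB B); have idO := alg_hom_id (O : grAlgType K).
have [[lv _] [lD _] [le _]] := And3 hv hD he.
have [[liX _] [liO _]] := conj idX idO.
split.
- apply: gr_hom_of_gen => // i; apply/homog_manin; rewrite -/(Xgen B i) dM.
  rewrite raddf_sum; apply: eq_bigr => j _ /=.
  by rewrite tbiproj_pure M1 homog_gen.
- have h1 := alg_hom_comp (alg_hom_comp (tassoc_hom O O (XB B)) (tmap_hom hD idX)) hv.
  have h2 := alg_hom_comp (tmap_hom idO hv) hv.
  apply: (alg_hom_ext h1 h2) => i /=; rewrite -/(Xgen B i) dM.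
  rewrite (lin_sum _ _ _ (tmap_linear lD liX)) (lin_sum _ _ _ (tmap_linear liO lv)).
  rewrite (lin_sum _ _ _ (@tassoc_linear _ _ _ _)).
  under eq_bigr => j _ do
    rewrite tmap_pure // MD tpure_suml (lin_sum _ _ _ (@tassoc_linear _ _ _ _)).
  under [RHS]eq_bigr => j _ do rewrite tmap_pure //= dM tpure_sumr.
  rewrite exchange_big; apply: eq_bigr => j _; apply: eq_bigr => k _ /=.
  by rewrite tassoc_pure.
- have h1 := alg_hom_comp (alg_hom_comp (tlunit_hom (XB B)) (tmap_hom he idX)) hv.
  apply: (alg_hom_ext h1 idX) => i /=; rewrite -/(Xgen B i) dM.
  rewrite (lin_sum _ _ _ (tmap_linear le liX)) (lin_sum _ _ _ (@tlunit_linear _ _)).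
  under eq_bigr => j _ do rewrite tmap_pure // tlunit_pure -/(epsilon_ _) Me.
  rewrite (bigD1 i) //= eqxx scale1r big1 ?addr0 // => j.
  by rewrite eq_sym => /negPf ->; rewrite scale0r.
Qed.

Lemma coaction_by_inj d d' M : alg_hom d -> alg_hom d' ->
  coaction_by d M -> coaction_by d' M -> d = d'.
Proof.
move=> hd hd' dM d'M; apply/funext; apply: alg_hom_ext => // i.
by apply: manin_inj; rewrite -/(Xgen B i) dM d'M.
Qed.

(** The matrix can be read off because the generators are independent. *)
Lemma coaction_by_mx d M M' : coaction_by d M -> coaction_by d M' -> M = M'.
Proof.
move=> dM dM'; apply/matrixP => i.
by apply: (@tpure_gen_inj _ _ B); rewrite -dM -dM'.
Qed.

Variable Bid : idempotent2 B.
Implicit Types (w : coend Bid -> O).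

Lemma corep_of_multiplicative M : first_order M -> multiplicative_mx M ->
  ManinMx B M -> exists w, corep w /\ corep_by w M.
Proof.
move=> M1 [MD Me] /ManinMxP sat.
pose w : coend Bid -> O := qlift (coend_rel B) (fun p => M p.1 p.2).
have wM i j : w (coend_gen B i j) = M i j by rewrite /w qlift_gen.
have gw : gr_hom w by apply: qlift_gr_hom => // -[i j]; exact: M1.
exists w; split=> //; have [hw _] := gw; have [lw _] := hw.
have [heO _] := epsilon_hom O; have [heC _] := epsilon_hom (coend Bid).
have [hDC _] := Delta_hom (coend Bid).
split=> //.
- have h1 := alg_hom_comp Delta_alg_hom hw.
  have h2 := alg_hom_comp (tmap_hom hw hw) (alg_hom_val hDC).
  apply: (alg_hom_ext h1 h2) => -[i j] /=; rewrite -/(coend_gen B i j) wM MD.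
  rewrite coend_Delta_gen (lin_sum _ _ _ (tmap_linear lw lw)).
  by apply: eq_bigr => k _; rewrite tmap_pure // !wM.
- apply: (alg_hom_ext (alg_hom_comp heO hw) heC) => -[i j] /=.
  rewrite -/(coend_gen B i j) wM coend_epsilon_gen //.
  (* A homogeneous polynomial of degree one is determined by its value at 1. *)
  have [_ /(_ 1%N _ (M1 i j)) e1] := epsilon_hom O.
  have eX : epsilon (M i j) = (epsilon (M i j))`_1 *: 'X by rewrite -[LHS]e1.
  by have := Me i j; rewrite /epsilon_ eX hornerZ hornerX mulr1 => ->.
Qed.

Lemma corep_by_inj w w' M : corep w -> corep w' ->
  corep_by w M -> corep_by w' M -> w = w'.
Proof.
move=> [[hw _] _ _] [[hw' _] _ _] wM w'M; apply/funext.
by apply: (alg_hom_ext hw hw') => -[i j]; rewrite -/(coend_gen B i j) wM w'M.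
Qed.

Lemma theta_corep_by w d M : theta w d -> coaction_by d M -> corep_by w M.
Proof.
by move=> [_ _ [M' [wM' dM']]] dM; rewrite (coaction_by_mx dM dM').
Qed.

(** Two coactions related to the same [w] have the same matrix, namely the
    values of [w] on the generators of the universal comonoid. *)
Lemma theta_fun w d d' : theta w d -> theta w d' -> d = d'.
Proof.
move=> [_ [[hd _] _ _] [M [wM dM]]] [_ [[hd' _] _ _] [M' [wM' dM']]].
apply: (coaction_by_inj hd hd' dM).
suff -> : M = M' by [].
by apply/matrixP => i j; rewrite -wM wM'.
Qed.

End FromMatrix.

(** * The direct sum of two coactions *)

Section DirectSumCriterion.
Variables (K : fieldType) (O : comonoid K) (B C : grAlgType K).
Variables (d : B -> manin O B) (g : C -> manin O C).
Hypotheses (hd : alg_hom d) (hg : alg_hom g).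
Local Notation T := (tens O (tens B C)).

Definition tpure1r (b : B) : tens B C := tpure b 1.
Definition tpure1l (c : C) : tens B C := tpure 1 c.

Lemma tpure1r_hom : alg_hom tpure1r.
Proof.
split=> [c x y|]; first by rewrite /tpure1r tpureDl tpureZl.
by split=> // x y; rewrite /tpure1r tpureM mulr1.
Qed.
Lemma tpure1l_hom : alg_hom tpure1l.
Proof.
split=> [c x y|]; first by rewrite /tpure1l tpureDr tpureZr.
by split=> // x y; rewrite /tpure1l tpureM mulr1.
Qed.

Definition dplus_left (b : B) : T := tmap id tpure1r (manin_val (d b)).
Definition dplus_right (c : C) : T := tmap id tpure1l (manin_val (g c)).

Lemma dplus_left_hom : alg_hom dplus_left.
Proof.
apply: (alg_hom_comp (tmap_hom (alg_hom_id O) tpure1r_hom)).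
exact: alg_hom_val.
Qed.
Lemma dplus_right_hom : alg_hom dplus_right.
Proof.
apply: (alg_hom_comp (tmap_hom (alg_hom_id O) tpure1l_hom)).
exact: alg_hom_val.
Qed.

(** On pure tensors both sides are [a a' ⊗ (b ⊗ c)]. *)
Lemma tmult_flip_pure (s : tens O B) (t : tens O C) :
  tmap (@tmult K O) id (tflip (tpure s t)) = tmap id tpure1r s * tmap id tpure1l t.
Proof.
have [ll _] := tpure1r_hom; have [lr _] := tpure1l_hom.
have lO : linear (@id O) by []; have lT : linear (@id (tens B C)) by [].
have lm := tmap_linear (tmult_linear (A := O)) lT.
elim/tens_ind: s => [a b|s s' hs hs']; last first.
  rewrite tpureDl (linD (@tflip_linear _ _ _ _ _)) (linD lm) hs hs'.
  by rewrite (linD (tmap_linear lO ll)) mulrDl.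
elim/tens_ind: t => [a' c|t t' ht ht']; last first.
  rewrite tpureDr (linD (@tflip_linear _ _ _ _ _)) (linD lm) ht ht'.
  by rewrite (linD (tmap_linear lO lr)) mulrDr.
rewrite tflip_pure (tmap_pure _ _ (tmult_linear (A := O)) lT) tmult_pure.
by rewrite !tmap_pure // tpureM /tpure1r /tpure1l tpureM mulr1 mul1r.
Qed.

Lemma dplus_pure b c :
  manin_val (dplus d g (tpure b c)) = dplus_left b * dplus_right c.
Proof.
have [ld _] := alg_hom_val hd; have [lg _] := alg_hom_val hg.
by rewrite /= /dplus_val tmap_pure //= tmult_flip_pure.
Qed.

(** [B ⊗ C] is generated by its commuting subalgebras [B] and [C], so a linear
    map of the form [b ⊗ c |-> L b * R c], for homomorphisms [L] and [R], is
    multiplicative exactly when their images commute. *)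
Lemma dsum_existsP :
  dsum_exists d g <->
  (forall b c, dplus_left b * dplus_right c = dplus_right c * dplus_left b).
Proof.
have [ll [l1 lM]] := dplus_left_hom; have [lr [r1 rM]] := dplus_right_hom.
split=> [[_ [_ hM]] b c|LR].
  (* Evaluate the direct sum on [b ⊗ c = (1 ⊗ c) (b ⊗ 1)]. *)
  have e : tpure b c = tpure1l c * tpure1r b by rewrite tpureM mulr1 mul1r.
  rewrite -dplus_pure e hM -[LHS]/(manin_val _ * manin_val _).
  by rewrite !dplus_pure l1 r1 mul1r mulr1.
have bf : bilin (fun b c => dplus_left b * dplus_right c).
  split=> [c k x y|b k x y]; first by rewrite ll mulrDl scalerAl.
  by rewrite lr mulrDr scalerAr.
have hf : alg_hom (tlift (fun b c => dplus_left b * dplus_right c)).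
  apply: tlift_hom => //; first by rewrite l1 r1 mulr1.
  by move=> b b' c c'; rewrite lM rM -!mulrA; congr (_ * _); rewrite !mulrA LR.
apply: alg_hom_into_manin.
suff -> : @manin_val _ _ _ \o dplus d g =
          tlift (fun b c => dplus_left b * dplus_right c) by [].
have [ld _] := alg_hom_val hd; have [lg _] := alg_hom_val hg.
have lT : linear (@id (tens B C)) by [].
apply/funext; apply: tens_ext => [k x y||b c].
- rewrite /= /dplus_val (tmap_linear ld lg) (@tflip_linear K O B O C).
  exact: (tmap_linear (tmult_linear (A := O)) lT).
- by have [] := hf.
- by rewrite (tlift_pure _ _ bf) -dplus_pure.
Qed.

End DirectSumCriterion.

Section DirectSumMatrix.
Variables (K : fieldType) (O : comonoid K) (m n : nat).
Variables (B : end2 K m) (C : end2 K n) (M : 'M[O]_m) (N : 'M[O]_n).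
Variables (d : XB B -> manin O (XB B)) (g : XB C -> manin O (XB C)).
Hypotheses (hd : alg_hom d) (hg : alg_hom g).
Hypotheses (dM : coaction_by d M) (gN : coaction_by g N).

Lemma dplus_left_gen i : dplus_left (XB C) d (Xgen B i) =
  \sum_j tpure (M i j) (tpure (Xgen B j) 1).
Proof.
have lO : linear (@id O) by []; have [ll _] := tpure1r_hom (XB B) (XB C).
rewrite /dplus_left dM (lin_sum _ _ _ (tmap_linear lO ll)).
by apply: eq_bigr => j _; rewrite tmap_pure.
Qed.
Lemma dplus_right_gen a : dplus_right (XB B) g (Xgen C a) =
  \sum_b tpure (N a b) (tpure 1 (Xgen C b)).
Proof.
have lO : linear (@id O) by []; have [lr _] := tpure1l_hom (XB B) (XB C).
rewrite /dplus_right gN (lin_sum _ _ _ (tmap_linear lO lr)).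
by apply: eq_bigr => j _; rewrite tmap_pure.
Qed.

Lemma dplus_gen_commute i a :
  dplus_left (XB C) d (Xgen B i) * dplus_right (XB B) g (Xgen C a) =
  dplus_right (XB B) g (Xgen C a) * dplus_left (XB C) d (Xgen B i) <->
  forall j b, M i j * N a b = N a b * M i j.
Proof.
rewrite dplus_left_gen dplus_right_gen.
have -> : (\sum_j tpure (M i j) (tpure (Xgen B j) 1)) *
    (\sum_b tpure (N a b) (tpure 1 (Xgen C b))) =
    \sum_j \sum_b tpure (M i j * N a b) (tpure (Xgen B j) (Xgen C b))
    :> tens O (tens (XB B) (XB C)).
  rewrite mulr_suml; apply: eq_bigr => j _; rewrite mulr_sumr.
  by apply: eq_bigr => b _; rewrite !tpureM mulr1 mul1r.
have -> : (\sum_b tpure (N a b) (tpure 1 (Xgen C b))) *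
    (\sum_j tpure (M i j) (tpure (Xgen B j) 1)) =
    \sum_j \sum_b tpure (N a b * M i j) (tpure (Xgen B j) (Xgen C b))
    :> tens O (tens (XB B) (XB C)).
  rewrite mulr_sumr; apply: eq_bigr => j _; rewrite mulr_suml.
  by apply: eq_bigr => b _; rewrite !tpureM mulr1 mul1r.
split=> [h j b|h]; last by under eq_bigr do under eq_bigr do rewrite h.
(* Slice by the functional on the tensor product of the two algebras that
   detects [w^j ⊗ w^b]. *)
have [phi [pl ph]] := deg1_functional B j.
have [psi [ql qh]] := deg1_functional C b.
have bpp : bilin (fun x y => (phi x * psi y : K^o)).
  split=> [y k x x'|x k y y']; first by rewrite pl mulrDl -scalerAl.
  by rewrite ql mulrDr -scalerAr.
have lpp := tlift_linear bpp; have ls := tslice_linear (U := O) lpp.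
have e (F : 'I_m -> 'I_n -> O) :
    tslice (tlift (fun x y => (phi x * psi y : K^o)))
      (\sum_j \sum_b tpure (F j b) (tpure (Xgen B j) (Xgen C b))) = F j b.
  rewrite (lin_sum _ _ _ ls).
  under eq_bigr do rewrite (lin_sum _ _ _ ls).
  rewrite (@sum2_delta _ _ _ j b) => [|k c kc];
    rewrite tslice_pure // tlift_pure // ph qh; first by rewrite !eqxx mulr1 scale1r.
  by rewrite -natrM mulnb eq_sym (eq_sym b) kc scale0r.
by rewrite -[LHS](e (fun j b => M i j * N a b)) h e.
Qed.

Lemma dsum_exists_commute :
  dsum_exists d g <-> forall i j a b, M i j * N a b = N a b * M i j.
Proof.
rewrite dsum_existsP //; split=> [h i j a b|h b c].
  by have /dplus_gen_commute := h (Xgen B i) (Xgen C a); apply.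
have hl := dplus_left_hom (XB C) hd; have hr := dplus_right_hom (XB B) hg.
apply: (quad_hom_comm hl hr) => i a.
by apply/dplus_gen_commute => j b'; exact: h.
Qed.

(** One factor of [w^i ⊗ 1] or [1 ⊗ w^a] is trivial, so this holds whether or
    not the direct sum exists. *)
Lemma dplusX_by : coaction_by (dplusX d g) (block_mx M 0 0 N).
Proof.
have [_ [l1 _]] := dplus_left_hom (XB C) hd.
have [_ [r1 _]] := dplus_right_hom (XB B) hg.
have lX := XD_of_tens_linear (B := B) (C := C); have lO : linear (@id O) by [].
have [[_ [il _]] _] := XD_inl_hom B C; have [[_ [ir _]] _] := XD_inr_hom B C.
move=> i.
rewrite -[LHS]/(tmap id (@XD_of_tens K m n B C)
  (manin_val (dplus d g (@tens_of_XD K m n B C (Xgen (DiS B C) i))))).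
rewrite /tens_of_XD qlift_gen; last exact: tens_of_XD_sat.
rewrite big_split_ord [RHS]/=; case: (splitV i) => [j|a]; rewrite splitE dplus_pure //.
  rewrite r1 mulr1 dplus_left_gen (lin_sum _ _ _ (tmap_linear lO lX)).
  rewrite [X in _ = _ + X]big1 ?addr0 => [|b _]; last first.
    by rewrite block_mxEur mxE tpure0l.
  apply: eq_bigr => k _; rewrite tmap_pure // XD_of_tens_pure ir mulr1.
  by rewrite block_mxEul /XD_inl qlift_gen //; exact: XD_inl_sat.
rewrite l1 mul1r dplus_right_gen (lin_sum _ _ _ (tmap_linear lO lX)).
rewrite [X in _ = X + _]big1 ?add0r => [|b _]; last first.
  by rewrite block_mxEdl mxE tpure0l.
apply: eq_bigr => k _; rewrite tmap_pure // XD_of_tens_pure il mul1r.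
by rewrite block_mxEdr /XD_inr qlift_gen //; exact: XD_inr_sat.
Qed.

Lemma dplusX_hom : 2%N \notin [pchar K] -> dsum_exists d g ->
  alg_hom (dplusX d g).
Proof.
move=> K2 h; have [hX _] := XD_of_tens_hom B C K2.
have [hT _] := tens_of_XD_hom B C.
apply: alg_hom_into_manin.
apply: (alg_hom_comp (tmap_hom (alg_hom_id O) hX)).
exact: (alg_hom_val (alg_hom_comp h hT)).
Qed.

End DirectSumMatrix.

Lemma first_order_block (K : fieldType) (O : comonoid K) m n
    (M : 'M[O]_m) (N : 'M[O]_n) :
  first_order M -> first_order N -> first_order (block_mx M 0 0 N).
Proof.
move=> M1 N1 i j; case: (splitV i) => {}i; case: (splitV j) => {}j;
  by rewrite ?(block_mxEul, block_mxEur, block_mxEdl, block_mxEdr) ?mxE //;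
     exact: homog0.
Qed.

Lemma multiplicative_block (K : fieldType) (O : comonoid K) m n
    (M : 'M[O]_m) (N : 'M[O]_n) :
  multiplicative_mx M -> multiplicative_mx N ->
  multiplicative_mx (block_mx M 0 0 N).
Proof.
move=> [MD Me] [ND Ne]; have [lD _] := Delta_alg_hom O.
have [[le _] _] := epsilon_hom O.
have e0 : epsilon_ (0 : O) = 0 by rewrite /epsilon_ (lin0 le) horner0.
split=> i j; last first.
  case: (splitV i) => {}i; case: (splitV j) => {}j;
    rewrite ?(block_mxEul, block_mxEur, block_mxEdl, block_mxEdr) ?mxE ?e0 //.
  - by rewrite eq_lrshift.
  - by rewrite eq_rlshift.
  - by rewrite Ne (inj_eq (@rshift_inj _ _)).
rewrite big_split_ord /=.
case: (splitV i) => {}i; case: (splitV j) => {}j;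
  under eq_bigr do rewrite ?(block_mxEul, block_mxEur, block_mxEdl, block_mxEdr) ?mxE;
  under [X in _ = _ + X]eq_bigr do
    rewrite ?(block_mxEul, block_mxEur, block_mxEdl, block_mxEdr) ?mxE;
  rewrite ?(block_mxEul, block_mxEur, block_mxEdl, block_mxEdr) ?mxE.
- rewrite [X in _ + X]big1 ?addr0 ?MD // => k _; exact: tpure0l.
- by rewrite (lin0 lD) !big1 ?addr0 // => k _; rewrite (tpure0l, tpure0r).
- by rewrite (lin0 lD) !big1 ?addr0 // => k _; rewrite (tpure0l, tpure0r).
- rewrite [X in X + _]big1 ?add0r ?ND // => k _; exact: tpure0l.
Qed.

(** * The direct sum of two corepresentations *)

Theorem proposition5p11 (K : fieldType) (Kinf : infinite_set (@setT K))
    (K2 : 2%N \notin [pchar K]) (O : comonoid K) (m n : nat)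
    (B : end2 K m) (C : end2 K n) (Bid : idempotent2 B) (Cid : idempotent2 C)
    (M : 'M[O]_m) (N : 'M[O]_n)
    (M1 : first_order M) (Mmul : multiplicative_mx M) (MB : ManinMx B M)
    (N1 : first_order N) (Nmul : multiplicative_mx N) (NC : ManinMx C N)
    (delta : XB B -> manin O (XB B)) (gamma : XB C -> manin O (XB C))
    (deltaP : coaction delta) (gammaP : coaction gamma)
    (deltaM : coaction_by delta M) (gammaN : coaction_by gamma N)
    (omega : coend Bid -> O) (nu : coend Cid -> O)
    (omegaP : theta omega delta) (nuP : theta nu gamma) :
  let D := DiS B C in
  let Did := DiS_idem K2 Bid Cid in
  let MN : 'M[O]_(m + n) := block_mx M 0 0 N in
  let MN_commute :=
    forall i j a b, M i j * N a b = N a b * M i j in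
  [/\ dsum_exists delta gamma <-> MN_commute,
      corep_dsum_exists omega nu <-> MN_commute
    & MN_commute ->
      [/\ [/\ first_order MN, multiplicative_mx MN & ManinMx D MN],
          coaction (dplusX delta gamma),
          coaction_by (dplusX delta gamma) MN
        & exists omega_nu : coend Did -> O,
            [/\ is_corep_dplus omega nu omega_nu,
                (forall s : coend Did -> O,
                   is_corep_dplus omega nu s -> s = omega_nu)
              & corep_by omega_nu MN]]].
Proof.
move=> D Did MN MN_commute.
have [[hd _] _ _] := deltaP; have [[hg _] _ _] := gammaP.
have dsumP : dsum_exists delta gamma <-> MN_commute.
  exact: dsum_exists_commute.
split=> //.
  split=> [[d [g [wd vg h]]]|/dsumP h]; last by exists delta, gamma.
  by apply/dsumP; rewrite (theta_fun omegaP wd) (theta_fun nuP vg).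
move=> /dsumP h.
have hX : alg_hom (dplusX delta gamma) by exact: dplusX_hom.
have XMN : coaction_by (dplusX delta gamma) MN by exact: dplusX_by.
have MN1 : first_order MN by exact: first_order_block.
have MNmul : multiplicative_mx MN by exact: multiplicative_block.
have MND : ManinMx D MN by exact: (ManinMx_of_hom Did (alg_hom_val hX) XMN).
have Xcoact := coaction_of_multiplicative hX XMN MN1 MNmul.
split=> //.
have [s [hs sMN]] := corep_of_multiplicative Did MN1 MNmul MND.
exists s; split=> //.
  by exists delta, gamma; split=> //; split=> //; exists MN.
move=> s' [d [g [wd vg _ ths']]].
rewrite -(theta_fun omegaP wd) -(theta_fun nuP vg) in ths'.
have [hs' _ _] := ths'.
exact: (corep_by_inj hs' hs (theta_corep_by ths' XMN) sMN).
Qed.
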